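(* Let $\varphi$ and $\psi$ be degree-four rational maps on $\mathbb{P}^1$ over $k$, both satisfying $D\ne0$ and $$\frac{U_2^3}{2}-27U_3^2\ne0,$$ where $D$ and $U_1,\dots,U_6$ are the functions of the Clebsch–Gordan pair defined in the context. Then $\varphi$ and $\psi$ are conjugate if and only if $U_i(\varphi)=U_i(\psi)$ for $1\le i\le 6$.
   Context: $k$ is an algebraically closed field of characteristic zero, and $V_n$ is the space of binary forms of order (degree) $n$ in $x,y$ over $k$. A degree-four rational map is $\varphi=[f_0:f_1]$ with $f_0,f_1\in V_4$, $\mathrm{Res}(f_0,f_1)\neq0$, up to a common nonzero scalar; conjugate means conjugate under $\mathrm{PGL}_2(k)$. Its Clebsch–Gordan pair is $(F,G)=(yf_0-xf_1,(f_0)_x+(f_1)_y)\in V_5\oplus V_3$ (defined up to a common scalar); functions of $\varphi$ are evaluated at this pair. Transvectants: for binary forms $A,B$ of orders $m,n$, $$(A,B)_r=\frac{(m-r)!(n-r)!}{m!\,n!}\sum_{j=0}^r(-1)^j\binom rj\frac{\partial^rA}{\partial x^{r-j}\partial y^j}\frac{\partial^rB}{\partial x^j\partial y^{r-j}}.$$ Covariants: $H=(F,F)_2$, $i=(F,F)_4$, $t=(F,H)_1$, $c_{3,5}=(i,F)_1$, $c_{3,3}=(i,F)_2$; $h=(G,G)_2$, $q=(G,h)_1$, $D=(h,h)_2$. Joint invariants: $A=(F,Gh)_5$, $L=(F,hq)_5$, $B_1=(i,h)_2$, $B_2=(H,G^2)_6$, $M=(H,Gq)_6$, $N=(H,q^2)_6$,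 $R=(c_{3,3},G)_3$, $S_1=(c_{3,3},q)_3$, $S_2=(c_{3,5},Gh)_5$, $S_3=(t,G^3)_9$, $T_1=(c_{3,5},hq)_5$, $T_2=(t,G^2q)_9$, $T_3=(F^3,G^5)_{15}$, $W=(F^3,G^4q)_{15}$. Numerators: $P_1=700A$; $P_2=5^3\bigl(98010L^2+190080DN+47045DA^2+97000D^2B_2-19224D^2B_1\bigr)$; $P_3=5^5\bigl(63868314510AL^2+49446437040DLM+148589040600DAN+31976059115DA^3+560560D^2T_3-164989440D^2T_2-45305310960D^2T_1+98893534740D^2AB_2-39968032104D^2AB_1+7720750752D^3R\bigr)$; $P_4=-5\bigl(632610L^2+803520DN+165385DA^2+552680D^2B_2-98424D^2B_1\bigr)$; $P_5=-5^3\bigl(216453026790AL^2+514942187760DLM+493336803960DAN+112492234855DA^3+83523440D^2T_3-16672803840D^2T_2-290479054320D^2T_1+491566054980D^2AB_2-218716874376D^2AB_1-12670582496D^3R\bigr)$; $P_6=-5^6\bigl(67988850930L^4+197785748160DL^2N+33952803885DA^2L^2-560560D^2LW+79622318160D^2L^2B_2-39182280984D^2L^2B_1+19394519760D^2ALM-82457760D^3LS_3+21320456220D^3LS_2+9857393568D^3LS_1\bigr)$. With $(c_1,\dots,c_6)=(3,54,20432412,18,2270268,27027)$ and $(m_1,\dots,m_6)=(1,3,4,3,4,6)$, on $D\neq0$ put $U_i=P_i/(c_iD^{m_i})$. *)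

(* Defs.v *)
From Stdlib Require Import BinNat.
From mathcomp Require Import all_boot all_order all_algebra.
From mathcomp Require Import mpoly.

Set Implicit Arguments.
Unset Strict Implicit.
Unset Printing Implicit Defensive.

Import GRing.Theory.
Local Open Scope ring_scope.

(* Literals in ring_scope are unary naturals, which is unusable for the
   eleven- and twelve-digit coefficients below: [n%:K] evaluates a binary
   literal by Horner's rule inside the ring. *)
Fixpoint ring_of_pos (R : pzRingType) (p : positive) : R :=
  match p with
  | xH => 1
  | xO q => 2%:R * ring_of_pos R q
  | xI q => 2%:R * ring_of_pos R q + 1
  end.

Definition ring_of_N (R : pzRingType) (n : N) : R :=
  if n is Npos p then ring_of_pos R p else 0.

Notation "n %:K" := (ring_of_N _ n%num)
  (at level 1, left associativity, format "n %:K") : ring_scope.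

Lemma ring_of_NE (R : pzRingType) (n : N) :
  ring_of_N R n = (nat_of_bin n)%:R.
Proof.
have double m : (m.*2)%:R = 2%:R * m%:R :> R.
  by rewrite -addnn natrD mulr_natl mulr2n.
case: n => [|p] //=; elim: p => [p IHp|p IHp|] //=;
  rewrite IHp NatTrec.doubleE.
- by rewrite -[in RHS]natr1 double.
- by rewrite double.
Qed.

(* A binary form of order n is an n.-homog element of {mpoly k[2]}, with
   x = 'X_0 and y = 'X_1. *)

(* The exponent of x^a y^b. *)
Definition bmon (a b : nat) : 'X_{1..2} := (U_(0%R) *+ a + U_(1%R) *+ b)%MM.

(* The orders m, n of A and B are explicit arguments, since the zero form
   does not determine its order. *)
Definition transvectant (k : fieldType) (m n r : nat) (A B : {mpoly k[2]}) :
    {mpoly k[2]} :=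
  ((m - r)`!%:R * (n - r)`!%:R / (m`!%:R * n`!%:R)) *:
    \sum_(j < r.+1) ((-1) ^+ j * 'C(r, j)%:R) *:
      (mderivm (bmon (r - j) j) A *
       mderivm (bmon j (r - j)) B).

(* For two forms of the same order m the m-th transvectant is a constant. *)
Definition full_transvectant (k : fieldType) (m : nat) (A B : {mpoly k[2]}) : k :=
  (transvectant m m m A B)@_0%MM.

Definition bcoef (k : fieldType) (m : nat) (A : {mpoly k[2]}) (i : nat) : k :=
  A@_(bmon (m - i) i).

(* The homogeneous resultant of forms of orders m and n: the Sylvester
   determinant at the formal orders.  The library's [resultant] of the
   dehomogenised polynomials would miss a common zero at infinity. *)
Definition bresultant (k : fieldType) (m n : nat) (A B : {mpoly k[2]}) : k :=
  \det (\matrix_(i < n + m, j < n + m)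
    if (i < n)%N then
      (if (i <= j <= i + m)%N then bcoef m A (j - i) else 0)
    else
      (if (i - n <= j <= i - n + n)%N then bcoef n B (j - (i - n)) else 0)).

(* A lift (f_0, f_1) of a degree-d rational map [f_0 : f_1] of P^1; two lifts
   give the same map when they differ by a nonzero scalar, which is accounted
   for in [conjugate]. *)
Record ratmap (k : fieldType) (d : nat) := RatMap {
  rm_form :> 'I_2 -> {mpoly k[2]};
  rm_homog : forall i, rm_form i \is d.-homog;
  rm_res : bresultant d d (rm_form 0) (rm_form 1) != 0
}.

Definition lin_subst (k : fieldType) (M : 'M[k]_2) (p : {mpoly k[2]}) :
    {mpoly k[2]} :=
  p \mPo [tuple \sum_(j < 2) M i j *: 'X_j | i < 2].

(* M^-1 o f o M *)
Definition conj_lift (k : fieldType) (M : 'M[k]_2)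
    (f : 'I_2 -> {mpoly k[2]}) (i : 'I_2) : {mpoly k[2]} :=
  \sum_(j < 2) invmx M i j *: lin_subst M (f j).

(* Elements of PGL_2(k) are represented by invertible matrices; the scalar c
   expresses equality of rational maps. *)
Definition conjugate (k : fieldType) (d : nat) (phi psi : ratmap k d) : Prop :=
  exists (M : 'M[k]_2) (c : k),
    [/\ M \in unitmx, c != 0 & forall i, psi i = c *: conj_lift M phi i].

Definition cgF (k : fieldType) (d : nat) (phi : ratmap k d) : {mpoly k[2]} :=
  'X_1 * phi 0 - 'X_0 * phi 1.
Definition cgG (k : fieldType) (d : nat) (phi : ratmap k d) : {mpoly k[2]} :=
  (phi 0)^`M(0) + (phi 1)^`M(1).

(* Below F has order 5 and G has order 3. *)
Definition cov_H (k : fieldType) (F : {mpoly k[2]}) := transvectant 5 5 2 F F.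
Definition cov_i (k : fieldType) (F : {mpoly k[2]}) := transvectant 5 5 4 F F.
Definition cov_t (k : fieldType) (F : {mpoly k[2]}) :=
  transvectant 5 6 1 F (cov_H F).
Definition cov_c35 (k : fieldType) (F : {mpoly k[2]}) :=
  transvectant 2 5 1 (cov_i F) F.
Definition cov_c33 (k : fieldType) (F : {mpoly k[2]}) :=
  transvectant 2 5 2 (cov_i F) F.
Definition cov_h (k : fieldType) (G : {mpoly k[2]}) := transvectant 3 3 2 G G.
Definition cov_q (k : fieldType) (G : {mpoly k[2]}) :=
  transvectant 3 2 1 G (cov_h G).

Definition inv_D (k : fieldType) (G : {mpoly k[2]}) : k :=
  full_transvectant 2 (cov_h G) (cov_h G).
Definition inv_A (k : fieldType) (F G : {mpoly k[2]}) : k :=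
  full_transvectant 5 F (G * cov_h G).
Definition inv_L (k : fieldType) (F G : {mpoly k[2]}) : k :=
  full_transvectant 5 F (cov_h G * cov_q G).
Definition inv_B1 (k : fieldType) (F G : {mpoly k[2]}) : k :=
  full_transvectant 2 (cov_i F) (cov_h G).
Definition inv_B2 (k : fieldType) (F G : {mpoly k[2]}) : k :=
  full_transvectant 6 (cov_H F) (G ^+ 2).
Definition inv_M (k : fieldType) (F G : {mpoly k[2]}) : k :=
  full_transvectant 6 (cov_H F) (G * cov_q G).
Definition inv_N (k : fieldType) (F G : {mpoly k[2]}) : k :=
  full_transvectant 6 (cov_H F) (cov_q G ^+ 2).
Definition inv_R (k : fieldType) (F G : {mpoly k[2]}) : k :=
  full_transvectant 3 (cov_c33 F) G.
Definition inv_S1 (k : fieldType) (F G : {mpoly k[2]}) : k :=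
  full_transvectant 3 (cov_c33 F) (cov_q G).
Definition inv_S2 (k : fieldType) (F G : {mpoly k[2]}) : k :=
  full_transvectant 5 (cov_c35 F) (G * cov_h G).
Definition inv_S3 (k : fieldType) (F G : {mpoly k[2]}) : k :=
  full_transvectant 9 (cov_t F) (G ^+ 3).
Definition inv_T1 (k : fieldType) (F G : {mpoly k[2]}) : k :=
  full_transvectant 5 (cov_c35 F) (cov_h G * cov_q G).
Definition inv_T2 (k : fieldType) (F G : {mpoly k[2]}) : k :=
  full_transvectant 9 (cov_t F) (G ^+ 2 * cov_q G).
Definition inv_T3 (k : fieldType) (F G : {mpoly k[2]}) : k :=
  full_transvectant 15 (F ^+ 3) (G ^+ 5).
Definition inv_W (k : fieldType) (F G : {mpoly k[2]}) : k :=
  full_transvectant 15 (F ^+ 3) (G ^+ 4 * cov_q G).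

Definition P1 (k : fieldType) (F G : {mpoly k[2]}) : k := 700%:K * inv_A F G.

Definition P2 (k : fieldType) (F G : {mpoly k[2]}) : k :=
  let D := inv_D G in let A := inv_A F G in let L := inv_L F G in
  let B1 := inv_B1 F G in let B2 := inv_B2 F G in let N := inv_N F G in
  5%:K ^+ 3 *
    (98010%:K * L ^+ 2 + 190080%:K * D * N + 47045%:K * D * A ^+ 2
     + 97000%:K * D ^+ 2 * B2 - 19224%:K * D ^+ 2 * B1).

Definition P3 (k : fieldType) (F G : {mpoly k[2]}) : k :=
  let D := inv_D G in let A := inv_A F G in let L := inv_L F G in
  let B1 := inv_B1 F G in let B2 := inv_B2 F G in
  let M := inv_M F G in let N := inv_N F G in let R := inv_R F G in
  let T1 := inv_T1 F G in let T2 := inv_T2 F G in let T3 := inv_T3 F G in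
  5%:K ^+ 5 *
    (63868314510%:K * A * L ^+ 2 + 49446437040%:K * D * L * M
     + 148589040600%:K * D * A * N + 31976059115%:K * D * A ^+ 3
     + 560560%:K * D ^+ 2 * T3 - 164989440%:K * D ^+ 2 * T2
     - 45305310960%:K * D ^+ 2 * T1 + 98893534740%:K * D ^+ 2 * A * B2
     - 39968032104%:K * D ^+ 2 * A * B1 + 7720750752%:K * D ^+ 3 * R).

Definition P4 (k : fieldType) (F G : {mpoly k[2]}) : k :=
  let D := inv_D G in let A := inv_A F G in let L := inv_L F G in
  let B1 := inv_B1 F G in let B2 := inv_B2 F G in let N := inv_N F G in
  - 5%:K *
    (632610%:K * L ^+ 2 + 803520%:K * D * N + 165385%:K * D * A ^+ 2
     + 552680%:K * D ^+ 2 * B2 - 98424%:K * D ^+ 2 * B1).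

Definition P5 (k : fieldType) (F G : {mpoly k[2]}) : k :=
  let D := inv_D G in let A := inv_A F G in let L := inv_L F G in
  let B1 := inv_B1 F G in let B2 := inv_B2 F G in
  let M := inv_M F G in let N := inv_N F G in let R := inv_R F G in
  let T1 := inv_T1 F G in let T2 := inv_T2 F G in let T3 := inv_T3 F G in
  - 5%:K ^+ 3 *
    (216453026790%:K * A * L ^+ 2 + 514942187760%:K * D * L * M
     + 493336803960%:K * D * A * N + 112492234855%:K * D * A ^+ 3
     + 83523440%:K * D ^+ 2 * T3 - 16672803840%:K * D ^+ 2 * T2
     - 290479054320%:K * D ^+ 2 * T1 + 491566054980%:K * D ^+ 2 * A * B2
     - 218716874376%:K * D ^+ 2 * A * B1 - 12670582496%:K * D ^+ 3 * R).

Definition P6 (k : fieldType) (F G : {mpoly k[2]}) : k :=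
  let D := inv_D G in let A := inv_A F G in let L := inv_L F G in
  let B1 := inv_B1 F G in let B2 := inv_B2 F G in
  let M := inv_M F G in let N := inv_N F G in let W := inv_W F G in
  let S1 := inv_S1 F G in let S2 := inv_S2 F G in let S3 := inv_S3 F G in
  - 5%:K ^+ 6 *
    (67988850930%:K * L ^+ 4 + 197785748160%:K * D * L ^+ 2 * N
     + 33952803885%:K * D * A ^+ 2 * L ^+ 2 - 560560%:K * D ^+ 2 * L * W
     + 79622318160%:K * D ^+ 2 * L ^+ 2 * B2
     - 39182280984%:K * D ^+ 2 * L ^+ 2 * B1
     + 19394519760%:K * D ^+ 2 * A * L * M
     - 82457760%:K * D ^+ 3 * L * S3 + 21320456220%:K * D ^+ 3 * L * S2
     + 9857393568%:K * D ^+ 3 * L * S1).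

(* The following functions of a degree-four map do not depend on the lift. *)
Definition Dinv (k : fieldType) (phi : ratmap k 4) : k := inv_D (cgG phi).

Definition U1 (k : fieldType) (phi : ratmap k 4) : k :=
  P1 (cgF phi) (cgG phi) / (3%:K * Dinv phi ^+ 1).
Definition U2 (k : fieldType) (phi : ratmap k 4) : k :=
  P2 (cgF phi) (cgG phi) / (54%:K * Dinv phi ^+ 3).
Definition U3 (k : fieldType) (phi : ratmap k 4) : k :=
  P3 (cgF phi) (cgG phi) / (20432412%:K * Dinv phi ^+ 4).
Definition U4 (k : fieldType) (phi : ratmap k 4) : k :=
  P4 (cgF phi) (cgG phi) / (18%:K * Dinv phi ^+ 3).
Definition U5 (k : fieldType) (phi : ratmap k 4) : k :=
  P5 (cgF phi) (cgG phi) / (2270268%:K * Dinv phi ^+ 4).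
Definition U6 (k : fieldType) (phi : ratmap k 4) : k :=
  P6 (cgF phi) (cgG phi) / (27027%:K * Dinv phi ^+ 6).

(* Main.v *)
(* D <> 0 says that the cubic G has three distinct roots.  Moving the two roots
   of its Hessian to 0 and infinity and rescaling turns G into x^3 + y^3; the
   substitutions still available then act as S_3, generated by y |-> z y with
   z^3 = 1 and by the exchange of x and y.  Write the transformed quintic as
   F = sum_i binomial(5, i) a_i x^(5-i) y^i and put p = a_0 + 98 a_3,
   p' = a_5 + 98 a_2.  Up to nonzero constants
     U_1 = a_4 - a_1,  U_2 = p p',  U_3 = p^3 - p'^3,
     U_6 = (a_1 + a_4) (p^3 + p'^3),
   while, modulo U_2 and U_3, U_4 and U_5 are p a_2 + p' a_3 and
   p'^2 a_2 - p^2 a_3.  The excluded quantity U_2^3 / 2 - 27 U_3^2 is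
   a multiple of (p^3 + p'^3)^2.  So U_2 and U_3 determine (p, p') up to S_3,
   and once p and p' are known the remaining four equations are a linear system
   in a_1, .., a_4 of determinant a nonzero multiple of (p^3 + p'^3)^2.
   Conjugacy of maps is equivalence of the pairs (F, G) because
   5 f_0 = F_y + x G and 5 f_1 = y G - F_x. *)

From Stdlib Require Import BinNat.
Require Import Defs.
From mathcomp Require Import all_boot all_order all_algebra.
From mathcomp Require Import mpoly.
From mathcomp Require Import ring.

Set Implicit Arguments.
Unset Strict Implicit.
Unset Printing Implicit Defensive.

Import GRing.Theory.
Local Open Scope ring_scope.

(** * Covariance of transvectants *)

(** The product case of the chain rule [mderiv_lin_subst], isolated so that [ring] meets variables
    of an abstract ring instead of polynomials. *)
Lemma leibniz_comb (R : comPzRingType) (u v p p0 p1 q q0 q1 : R) :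
  (u * p0 + v * p1) * q + p * (u * q0 + v * q1) =
  u * (p0 * q + p * q0) + v * (p1 * q + p * q1).
Proof. ring. Qed.

(** The induction step of [omega_lin_subst]: the unmixed terms in [x] and [w] cancel, and the mixed
    ones leave the factor $ad-bc$. *)
Lemma omega_comb (R : comPzRingType) (a b c d e x y z w : R) :
  a * b * (e * x) + c * b * (e * y) + (a * d * (e * z) + c * d * (e * w)) -
  (b * a * (e * x) + d * a * (e * y) + (b * c * (e * z) + d * c * (e * w))) =
  ((a * d - b * c) * e) * (z - y).
Proof. ring. Qed.

Section Covariance.
Variable k : fieldType.
Implicit Types (A B p : {mpoly k[2]}) (M N : 'M[k]_2).

Lemma det_mx2 M : \det M = M 0 0 * M 1 1 - M 0 1 * M 1 0.
Proof.
rewrite (expand_det_row _ ord0) 2!big_ord_recl big_ord0 /cofactor !det_mx11 !mxE.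
have l0 : lift ord0 ord0 = 1 :> 'I_2 by exact: val_inj.
have l1 : lift 1 ord0 = 0 :> 'I_2 by exact: val_inj.
by rewrite !l0 !l1 /= expr0 expr1; ring.
Qed.

(* Cayley's Omega process: each step contributes one factor [\det M] to the
   covariance law [omega_lin_subst]. *)
Fixpoint omega (r : nat) A B : {mpoly k[2]} :=
  if r is r'.+1 then omega r' A^`M(0) B^`M(1) - omega r' A^`M(1) B^`M(0)
  else A * B.

Lemma omegaDl r A A' B : omega r (A + A') B = omega r A B + omega r A' B.
Proof.
by elim: r A A' B => [|r IH] A A' B /=; rewrite ?mulrDl // !mderivD !IH; ring.
Qed.

Lemma omegaDr r A B B' : omega r A (B + B') = omega r A B + omega r A B'.
Proof.
by elim: r A B B' => [|r IH] A B B' /=; rewrite ?mulrDr // !mderivD !IH; ring.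
Qed.

Lemma omegaZl r a A B : omega r (a *: A) B = a *: omega r A B.
Proof.
by elim: r A B => [|r IH] A B /=; rewrite ?scalerAl // !mderivZ !IH scalerBr.
Qed.

Lemma omegaZr r a A B : omega r A (a *: B) = a *: omega r A B.
Proof.
by elim: r A B => [|r IH] A B /=; rewrite ?scalerAr // !mderivZ !IH scalerBr.
Qed.

Lemma mderivm_bmon a b A i :
  mderivm (bmon a b) A^`M(i) =
  mderivm (if i == 0 then bmon a.+1 b else bmon a b.+1) A.
Proof.
rewrite -mderivmU1m -mderivmDm; congr (mderivm _ A); rewrite /bmon.
case: i => [[|[|//]] lti] /=; apply/mnmP => j; rewrite !(mnmDE, mulmnE, mnm1E);
  by case: j => [[|[|//]] ltj]; rewrite !eqE /= ?mul1n ?mul0n ?addn0 ?addn1.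
Qed.

(** Induction by Pascal's rule: both terms of the recursion are sums over the same products [t j],
    with indices shifted by one. *)
Lemma omegaE r A B : omega r A B =
  \sum_(j < r.+1) ((-1) ^+ j * 'C(r, j)%:R) *:
    (mderivm (bmon (r - j) j) A * mderivm (bmon j (r - j)) B).
Proof.
elim: r A B => [|r IH] A B /=.
  rewrite big_ord_recl big_ord0 bin0 expr0 mul1r scale1r addr0 /=.
  by rewrite /bmon !mulm0n addm0 !mderivm0m.
pose t j := mderivm (bmon (r.+1 - j) j) A * mderivm (bmon j (r.+1 - j)) B.
have -> : omega r A^`M(0) B^`M(1) =
    \sum_(j < r.+2) ((-1) ^+ j * 'C(r, j)%:R) *: t j.
  (* The last term of the lengthened sum carries $\binom{r}{r+1}=0$. *)
  rewrite big_ord_recr /= bin_small // mulr0 scale0r addr0 IH.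
  by apply: eq_bigr => j _; rewrite !mderivm_bmon /t /= subSn // -ltnS.
have -> : omega r A^`M(1) B^`M(0) =
    \sum_(j < r.+1) ((-1) ^+ j * 'C(r, j)%:R) *: t j.+1.
  by rewrite IH; apply: eq_bigr => j _; rewrite !mderivm_bmon /t /= subSS.
rewrite big_ord_recl [RHS]big_ord_recl /= !bin0 -addrA -sumrB.
congr (_ + _); apply: eq_bigr => j _; rewrite /bump add1n binS natrD exprS.
by rewrite -scalerBl; congr (_ *: _); ring.
Qed.

Lemma lin_substX M i : lin_subst M 'X_i = M i 0 *: 'X_0 + M i 1 *: 'X_1.
Proof.
rewrite /lin_subst comp_mpolyXU -tnth_nth tnth_mktuple 2!big_ord_recl big_ord0.
by rewrite addr0 (_ : lift _ _ = 1) //; apply: val_inj.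
Qed.

Lemma lin_substZ M a p : lin_subst M (a *: p) = a *: lin_subst M p.
Proof. exact: comp_mpolyZ. Qed.

Lemma lin_substD M p p' : lin_subst M (p + p') = lin_subst M p + lin_subst M p'.
Proof. exact: comp_mpolyD. Qed.

Lemma lin_substB M p p' : lin_subst M (p - p') = lin_subst M p - lin_subst M p'.
Proof. exact: comp_mpolyB. Qed.

Lemma lin_substM M p p' : lin_subst M (p * p') = lin_subst M p * lin_subst M p'.
Proof. exact: rmorphM. Qed.

Lemma lin_substXn M p n : lin_subst M (p ^+ n) = lin_subst M p ^+ n.
Proof. exact: rmorphXn. Qed.

Lemma lin_substC M a : lin_subst M a%:MP = a%:MP.
Proof. exact: comp_mpolyC. Qed.

(** Constants and variables generate the ring, so statements about substitutions and derivations
    need checking only on generators, sums and products. *)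
Lemma mpoly2_ind (P : {mpoly k[2]} -> Prop) :
  (forall a, P a%:MP) -> (forall i, P 'X_i) ->
  (forall p q, P p -> P q -> P (p + q)) ->
  (forall p q, P p -> P q -> P (p * q)) -> forall p, P p.
Proof.
move=> PC PX PD PM p; rewrite [p]mpolyE.
apply: (big_ind P) => [|//|m _]; first by rewrite -mpolyC0.
rewrite -mul_mpolyC; apply: (PM) => //; rewrite mpolyXE_id.
elim/big_ind: _ => [|p1 p2|i _]; [by rewrite -mpolyC1 | exact: PM |].
by elim: (m i) => [|n IH]; [rewrite expr0 -mpolyC1 | rewrite exprS; apply: (PM)].
Qed.

(** Substitution is contravariant: as a function on vectors, the left side is $p\circ N\circ M$. *)
Lemma lin_subst_comp M N p :
  lin_subst M (lin_subst N p) = lin_subst (N *m M) p.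
Proof.
elim/mpoly2_ind: p => [a|i|p q IHp IHq|p q IHp IHq]; last 2 first.
- by rewrite !lin_substD IHp IHq.
- by rewrite !lin_substM IHp IHq.
- by rewrite !lin_substC.
rewrite !lin_substX lin_substD !lin_substZ !lin_substX !mxE !big_ord_recl !big_ord0.
rewrite (_ : lift _ _ = 1); last exact: val_inj.
by rewrite -!mul_mpolyC !rmorphD !rmorphM /=; ring.
Qed.

Lemma lin_subst1 p : lin_subst 1%:M p = p.
Proof.
rewrite -[RHS]comp_mpoly_id; congr comp_mpoly; apply: eq_from_tnth => i.
by rewrite !tnth_mktuple (bigD1 i) //= mxE eqxx scale1r big1 ?addr0 // => j;
  rewrite mxE eq_sym => /negbTE ->; rewrite scale0r.
Qed.

Lemma ord2_cases (i : 'I_2) : i = 0 \/ i = 1.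
Proof. by case: i => [[|[|//]] lti]; [left | right]; apply: val_inj. Qed.

Lemma mderivXU i j : ('X_j : {mpoly k[2]})^`M(i) = (j == i)%:R%:MP.
Proof.
rewrite mderivX mnm1E; case: eqP => [->|_]; last by rewrite scale0r mpolyC0.
by rewrite scale1r -{1}[U_(i)%MM]add0m addmK mpolyX0.
Qed.

Lemma mderiv_lin_subst M p i :
  (lin_subst M p)^`M(i) =
  M 0 i *: lin_subst M p^`M(0) + M 1 i *: lin_subst M p^`M(1).
Proof.
elim/mpoly2_ind: p => [a|j|p q IHp IHq|p q IHp IHq].
- by rewrite lin_substC !mderivC -!mpolyC0 !lin_substC mpolyC0 !scaler0 addr0.
- rewrite lin_substX mderivD !mderivZ !mderivXU !lin_substC.
  rewrite -!mul_mpolyC -!mpolyCM -!mpolyCD; congr (_%:MP).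
  by case: (ord2_cases i) => ->; case: (ord2_cases j) => ->; rewrite /=; ring.
- by rewrite lin_substD !mderivD !lin_substD IHp IHq !scalerDr; exact: addrACA.
- rewrite lin_substM !mderivM IHp IHq !lin_substD !lin_substM -!mul_mpolyC.
  exact: leibniz_comb.
Qed.

Lemma omega_bilinear r a b c d A A' B B' :
  omega r (a *: A + b *: A') (c *: B + d *: B') =
  (a * c) *: omega r A B + (b * c) *: omega r A' B +
  ((a * d) *: omega r A B' + (b * d) *: omega r A' B').
Proof.
rewrite omegaDr (omegaZr _ c) (omegaZr _ d) !omegaDl !omegaZl.
by rewrite !scalerDr !scalerA ![_ * c]mulrC ![_ * d]mulrC.
Qed.

(** The chain rule expands one Omega step bilinearly; antisymmetry then extracts one factor
    [\det M]. *)
Lemma omega_lin_subst r M A B :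
  omega r (lin_subst M A) (lin_subst M B) =
  \det M ^+ r *: lin_subst M (omega r A B).
Proof.
elim: r A B => [|r IH] A B; first by rewrite /= expr0 scale1r lin_substM.
rewrite [LHS]/= !mderiv_lin_subst !omega_bilinear !IH.
rewrite [omega r.+1 A B]/= lin_substB exprS det_mx2 -!mul_mpolyC.
rewrite !(mpolyCM, mpolyCB).
exact: omega_comb.
Qed.

Lemma transvectantE m n r A B : transvectant m n r A B =
  ((m - r)`!%:R * (n - r)`!%:R / (m`!%:R * n`!%:R)) *: omega r A B.
Proof. by rewrite omegaE. Qed.

Lemma transvectant_lin_subst m n r M a b A B :
  transvectant m n r (a *: lin_subst M A) (b *: lin_subst M B) =
  (a * b * \det M ^+ r) *: lin_subst M (transvectant m n r A B).
Proof.
rewrite !transvectantE omegaZl omegaZr omega_lin_subst lin_substZ.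
by rewrite -!mul_mpolyC !mulrA -!mpolyCM; congr (_%:MP * _); ring.
Qed.

(** Linear forms have no constant term. This is what turns full transvectants into invariants. *)
Lemma mcoeff0_lin_subst M p : (lin_subst M p)@_0 = p@_0.
Proof.
elim/mpoly2_ind: p => [a|i|p q IHp IHq|p q IHp IHq]; last 2 first.
- by rewrite lin_substD !mcoeffD IHp IHq.
- by rewrite lin_substM !rmorphM /= IHp IHq.
- by rewrite lin_substC.
by rewrite lin_substX mcoeffD !mcoeffZ !mcoeffX !mnm1_eq0 !mulr0 addr0.
Qed.

Lemma full_transvectant_lin_subst m M a b A B :
  full_transvectant m (a *: lin_subst M A) (b *: lin_subst M B) =
  a * b * \det M ^+ m * full_transvectant m A B.
Proof.
by rewrite /full_transvectant transvectant_lin_subst mcoeffZ mcoeff0_lin_subst.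
Qed.

End Covariance.

(** * Weights of the joint invariants *)

Section Invariants.
Variables (k : fieldType) (M : 'M[k]_2) (a : k) (F G : {mpoly k[2]}).

Let d := \det M.
Let F' := a *: lin_subst M F.
(** The two factors follow the action of conjugation on Clebsch-Gordan pairs in [cg_conj], with [a]
    standing for [c / \det M]. *)
Let G' := (a * d) *: lin_subst M G.

Lemma lin_subst_mulZ b c A B :
  (b *: lin_subst M A) * (c *: lin_subst M B) = (b * c) *: lin_subst M (A * B).
Proof. by rewrite -scalerAl -scalerAr scalerA lin_substM. Qed.

Lemma lin_subst_expZ b A n :
  (b *: lin_subst M A) ^+ n = b ^+ n *: lin_subst M (A ^+ n).
Proof. by rewrite exprZn lin_substXn. Qed.

Lemma cov_h_lin : cov_h G' = ((a * d) ^+ 2 * d ^+ 2) *: lin_subst M (cov_h G).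
Proof. by rewrite /cov_h transvectant_lin_subst expr2. Qed.

Lemma cov_q_lin : cov_q G' = ((a * d) ^+ 3 * d ^+ 3) *: lin_subst M (cov_q G).
Proof.
by rewrite /cov_q cov_h_lin transvectant_lin_subst -/d; congr (_ *: _); ring.
Qed.

Lemma cov_H_lin : cov_H F' = (a ^+ 2 * d ^+ 2) *: lin_subst M (cov_H F).
Proof. by rewrite /cov_H transvectant_lin_subst. Qed.

Lemma cov_i_lin : cov_i F' = (a ^+ 2 * d ^+ 4) *: lin_subst M (cov_i F).
Proof. by rewrite /cov_i transvectant_lin_subst. Qed.

Lemma cov_t_lin : cov_t F' = (a ^+ 3 * d ^+ 3) *: lin_subst M (cov_t F).
Proof.
by rewrite /cov_t cov_H_lin transvectant_lin_subst -/d; congr (_ *: _); ring.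
Qed.

Lemma cov_c35_lin : cov_c35 F' = (a ^+ 3 * d ^+ 5) *: lin_subst M (cov_c35 F).
Proof.
by rewrite /cov_c35 cov_i_lin transvectant_lin_subst -/d; congr (_ *: _); ring.
Qed.

Lemma cov_c33_lin : cov_c33 F' = (a ^+ 3 * d ^+ 6) *: lin_subst M (cov_c33 F).
Proof.
by rewrite /cov_c33 cov_i_lin transvectant_lin_subst -/d; congr (_ *: _); ring.
Qed.

Definition cov_lin := (cov_h_lin, cov_q_lin, cov_H_lin, cov_i_lin, cov_t_lin,
  cov_c35_lin, cov_c33_lin, lin_subst_expZ, lin_subst_mulZ,
  full_transvectant_lin_subst).

(** Each invariant below is multiplied by a power of $a^2d^5$: the exponent is 2 for $D$ and ranges
    from 2 to 5. *)
Lemma inv_D_lin : inv_D G' = a ^+ 4 * d ^+ 10 * inv_D G.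
Proof. by rewrite /inv_D !cov_lin -/d; ring. Qed.

Lemma inv_A_lin : inv_A F' G' = a ^+ 4 * d ^+ 10 * inv_A F G.
Proof. by rewrite /inv_A !cov_lin -/d; ring. Qed.

Lemma inv_L_lin : inv_L F' G' = a ^+ 6 * d ^+ 15 * inv_L F G.
Proof. by rewrite /inv_L !cov_lin -/d; ring. Qed.

Lemma inv_B1_lin : inv_B1 F' G' = a ^+ 4 * d ^+ 10 * inv_B1 F G.
Proof. by rewrite /inv_B1 !cov_lin -/d; ring. Qed.

Lemma inv_B2_lin : inv_B2 F' G' = a ^+ 4 * d ^+ 10 * inv_B2 F G.
Proof. by rewrite /inv_B2 !cov_lin -/d; ring. Qed.

Lemma inv_M_lin : inv_M F' G' = a ^+ 6 * d ^+ 15 * inv_M F G.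
Proof. by rewrite /inv_M !cov_lin -/d; ring. Qed.

Lemma inv_N_lin : inv_N F' G' = a ^+ 8 * d ^+ 20 * inv_N F G.
Proof. by rewrite /inv_N !cov_lin -/d; ring. Qed.

Lemma inv_R_lin : inv_R F' G' = a ^+ 4 * d ^+ 10 * inv_R F G.
Proof. by rewrite /inv_R !cov_lin -/d; ring. Qed.

Lemma inv_S1_lin : inv_S1 F' G' = a ^+ 6 * d ^+ 15 * inv_S1 F G.
Proof. by rewrite /inv_S1 !cov_lin -/d; ring. Qed.

Lemma inv_S2_lin : inv_S2 F' G' = a ^+ 6 * d ^+ 15 * inv_S2 F G.
Proof. by rewrite /inv_S2 !cov_lin -/d; ring. Qed.

Lemma inv_S3_lin : inv_S3 F' G' = a ^+ 6 * d ^+ 15 * inv_S3 F G.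
Proof. by rewrite /inv_S3 !cov_lin -/d; ring. Qed.

Lemma inv_T1_lin : inv_T1 F' G' = a ^+ 8 * d ^+ 20 * inv_T1 F G.
Proof. by rewrite /inv_T1 !cov_lin -/d; ring. Qed.

Lemma inv_T2_lin : inv_T2 F' G' = a ^+ 8 * d ^+ 20 * inv_T2 F G.
Proof. by rewrite /inv_T2 !cov_lin -/d; ring. Qed.

Lemma inv_T3_lin : inv_T3 F' G' = a ^+ 8 * d ^+ 20 * inv_T3 F G.
Proof. by rewrite /inv_T3 !cov_lin -/d; ring. Qed.

Lemma inv_W_lin : inv_W F' G' = a ^+ 10 * d ^+ 25 * inv_W F G.
Proof. by rewrite /inv_W !cov_lin -/d; ring. Qed.

Definition inv_lin := (inv_D_lin, inv_A_lin, inv_L_lin, inv_B1_lin, inv_B2_lin,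
  inv_M_lin, inv_N_lin, inv_R_lin, inv_S1_lin, inv_S2_lin, inv_S3_lin,
  inv_T1_lin, inv_T2_lin, inv_T3_lin, inv_W_lin).

(** In each $P_i$ all terms have one weight, that of $D^{m_i}$, so the quotients $U_i$ are
    unchanged. *)
Lemma P1_lin : P1 F' G' = a ^+ 4 * d ^+ 10 * P1 F G.
Proof. by rewrite /P1 !inv_lin; ring. Qed.

Lemma P2_lin : P2 F' G' = (a ^+ 4 * d ^+ 10) ^+ 3 * P2 F G.
Proof. by rewrite /P2 !inv_lin; ring. Qed.

Lemma P3_lin : P3 F' G' = (a ^+ 4 * d ^+ 10) ^+ 4 * P3 F G.
Proof. by rewrite /P3 !inv_lin; ring. Qed.

Lemma P4_lin : P4 F' G' = (a ^+ 4 * d ^+ 10) ^+ 3 * P4 F G.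
Proof. by rewrite /P4 !inv_lin; ring. Qed.

Lemma P5_lin : P5 F' G' = (a ^+ 4 * d ^+ 10) ^+ 4 * P5 F G.
Proof. by rewrite /P5 !inv_lin; ring. Qed.

Lemma P6_lin : P6 F' G' = (a ^+ 4 * d ^+ 10) ^+ 6 * P6 F G.
Proof. by rewrite /P6 !inv_lin; ring. Qed.

End Invariants.

(** * Binary forms as lists of coefficients *)

Section Forms.
Variable k : fieldType.
Implicit Types (s t : seq k) (p : {mpoly k[2]}).

(* [bform [:: a0; ..; an]] is the form a0 x^n + a1 x^(n-1) y + .. + an y^n. *)
Fixpoint bform s : {mpoly k[2]} :=
  if s is a :: s' then a *: 'X_0 ^+ size s' + 'X_1 * bform s' else 0.

Fixpoint ladd s t : seq k :=
  match s, t with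
  | a :: s', b :: t' => a + b :: ladd s' t'
  | [::], _ => t
  | _, [::] => s
  end.

Definition lopp s := [seq - a | a <- s].

(** Trailing zeros multiply by a power of $x$ and a leading zero multiplies by $y$, so the two
    summands have equal length. The singleton case stands apart because [lmul [::] t] is empty and
    would break this. *)
Fixpoint lmul s t : seq k :=
  if s is a :: s' then
    if s' is [::] then [seq a * b | b <- t]
    else ladd ([seq a * b | b <- t] ++ nseq (size s') 0) (0 :: lmul s' t)
  else [::].

Fixpoint lexp s n : seq k :=
  if n is n'.+1 then lmul s (lexp s n') else [:: 1].

Fixpoint ldx s : seq k :=
  match s with
  | a :: (_ :: _) as s' => a *+ size s' :: ldx s'
  | _ => [::]
  end.

(** The exponent of $x$ can be read off the length of the tail, but that of $y$ has to be carried
    along as the counter [n]. *)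
Fixpoint ldy_from n s : seq k :=
  if s is a :: s' then a *+ n :: ldy_from n.+1 s' else [::].

Definition ldy s := ldy_from 1 (behead s).

Fixpoint lomega r s t : seq k :=
  if r is r'.+1 then
    ladd (lomega r' (ldx s) (ldy t)) (lopp (lomega r' (ldy s) (ldx t)))
  else lmul s t.

End Forms.

(** * List operations as operations on forms *)

Section FormsTheory.
Variable k : fieldType.
Implicit Types (s t : seq k) (p : {mpoly k[2]}).

Lemma size_ladd s t : size (ladd s t) = maxn (size s) (size t).
Proof. by elim: s t => [|a s IH] [|b t] //=; rewrite IH maxnSS. Qed.

Lemma lmul_cons2 a b s t : lmul [:: a, b & s] t =
  ladd ([seq a * c | c <- t] ++ nseq (size (b :: s)) 0) (0 :: lmul (b :: s) t).
Proof. by []. Qed.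

Lemma size_lmul s t : size (lmul s t) = if s is [::] then 0 else (size s + size t).-1.
Proof.
elim: s => [|a [|b s] IH]; rewrite ?size_map //.
rewrite lmul_cons2 size_ladd size_cat size_map size_nseq.
by rewrite [size (0 :: _)]/= IH /= addnS addnC maxnn addSn.
Qed.

Lemma size_ldx s : size (ldx s) = (size s).-1.
Proof. by elim: s => [|a [|b s] IH] //=; rewrite IH. Qed.

Lemma size_ldy_from n s : size (ldy_from n s) = size s.
Proof. by elim: s n => [|a s IH] n //=; rewrite IH. Qed.

Lemma size_ldy s : size (ldy s) = (size s).-1.
Proof. by rewrite size_ldy_from size_behead. Qed.

(** The length of a list encodes the degree of its form, so entrywise addition is meaningful only at
    equal lengths. *)
Lemma bform_add s t : size s = size t -> bform (ladd s t) = bform s + bform t.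
Proof.
elim: s t => [|a s IH] [|b t] //=; rewrite ?addr0 // => -[st].
by rewrite size_ladd -st maxnn IH // scalerDl mulrDr addrACA.
Qed.

Lemma bform_scale a s : bform [seq a * b | b <- s] = a *: bform s.
Proof.
by elim: s => [|b s IH] /=; rewrite ?scaler0 // IH size_map scalerDr scalerA scalerAr.
Qed.

Lemma bform_opp s : bform (lopp s) = - bform s.
Proof.
by elim: s => [|b s IH] /=; rewrite ?oppr0 // IH size_map opprD scaleNr mulrN.
Qed.

Lemma bform_cat0 s n : bform (s ++ nseq n 0) = 'X_0 ^+ n * bform s.
Proof.
elim: s => [|a s IH] /=.
  by rewrite mulr0; elim: n => //= n ->; rewrite scale0r add0r mulr0.
by rewrite IH size_cat size_nseq addnC exprD mulrDr -scalerAr mulrCA.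
Qed.

Lemma bform0s s : bform (0 :: s) = 'X_1 * bform s.
Proof. by rewrite /= scale0r add0r. Qed.

Lemma bform_mul s t : bform (lmul s t) = bform s * bform t.
Proof.
elim: s => [|a [|b s] IH]; rewrite ?mul0r //.
  by rewrite /= bform_scale expr0 mulr0 addr0 -scalerAl mul1r.
rewrite lmul_cons2 bform_add; last first.
  rewrite size_cat size_map size_nseq -[RHS]/(size (lmul (b :: s) t)).+1.
  by rewrite size_lmul /= addnC.
rewrite bform_cat0 bform0s IH bform_scale -scalerAr scalerAl mulrA -mulrDl.
by [].
Qed.

Lemma bform_exp s n : bform (lexp s n) = bform s ^+ n.
Proof.
elim: n => [|n IH]; first by rewrite /= expr0 mulr0 addr0 scale1r.
by rewrite /= bform_mul IH exprS.
Qed.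

Lemma mderivX0 n i : ('X_0 ^+ n : {mpoly k[2]})^`M(i) =
  (if i == 0 then n%:R else 0) *: 'X_0 ^+ n.-1.
Proof.
elim: n => [|n IH]; first by rewrite expr0 -mpolyC1 mderivC if_same scale0r.
rewrite exprS mderivM IH mderivXU /=.
case: (ord2_cases i) => ->; rewrite /= ?scale0r ?mulr0 ?mpolyC0 ?mul0r ?addr0 //.
case: n {IH} => [|n]; first by rewrite scale0r mulr0 addr0 expr0 mulr1 scale1r mpolyC1.
by rewrite mpolyC1 mul1r -scalerAr -exprS [in RHS]mulrS scalerDl scale1r.
Qed.

Lemma mderiv0_bform s : (bform s)^`M(0) = bform (ldx s).
Proof.
elim: s => [|a [|b s] IH]; first by rewrite mderiv0.
  by rewrite /= mulr0 addr0 mderivZ mderivX0 scale0r scaler0.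
rewrite [bform _ in LHS]/= -/(bform (b :: s)) mderivD mderivZ mderivX0 mderivM IH.
rewrite mderivXU mpolyC0 mul0r add0r scalerA mulr_natr.
rewrite -[RHS]/((a *+ size (b :: s)) *: 'X_0 ^+ size (ldx (b :: s)) + _).
by rewrite size_ldx.
Qed.

(** Multiplying the coefficient of $y^j$ by $n+j$ is $n$ plus the Euler operator $y\,\partial_y$. At
    $n=1$ this is the $y$-derivative of $y$ times the form. *)
Lemma bform_ldy_from n s :
  bform (ldy_from n s) = n%:R *: bform s + 'X_1 * (bform s)^`M(1).
Proof.
elim: s n => [|a s IH] n; first by rewrite /= mderiv0 scaler0 mulr0 addr0.
rewrite /= IH mderivD mderivZ mderivX0 mderivM mderivXU size_ldy_from /=.
rewrite scale0r scaler0 add0r mpolyC1 mul1r -natr1 scalerDl scale1r.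
rewrite scalerDr scalerA mulr_natl -[RHS]addrA scalerAr.
by rewrite -[in RHS]mulrDr addrA.
Qed.

Lemma mderiv1_bform s : (bform s)^`M(1) = bform (ldy s).
Proof.
case: s => [|a s]; first by rewrite mderiv0.
rewrite /ldy /= bform_ldy_from mderivD mderivZ mderivX0 mderivM mderivXU /=.
by rewrite scale0r scaler0 add0r mpolyC1 mul1r scale1r.
Qed.

Lemma eq_size_lmul s s' t t' : size s = size s' -> size t = size t' ->
  size (lmul s t) = size (lmul s' t').
Proof. by rewrite !size_lmul; case: s s' => [|a s] [|b s'] //= [->] ->. Qed.

Lemma eq_size_lomega r s s' t t' : size s = size s' -> size t = size t' ->
  size (lomega r s t) = size (lomega r s' t').
Proof.
elim: r s s' t t' => [|r IH] s s' t t' eqs eqt; first exact: eq_size_lmul.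
rewrite /= !size_ladd !size_map.
by congr (maxn _ _); apply: IH; rewrite !(size_ldx, size_ldy) ?eqs ?eqt.
Qed.

(** Reduces transvectants of explicit forms to a computation on lists of coefficients. *)
Lemma omega_bform r s t : omega r (bform s) (bform t) = bform (lomega r s t).
Proof.
elim: r s t => [|r IH] s t /=; first by rewrite bform_mul.
rewrite bform_add ?bform_opp ?mderiv0_bform ?mderiv1_bform ?IH //.
by rewrite size_map; apply: eq_size_lomega; rewrite size_ldx size_ldy.
Qed.

End FormsTheory.

(** * Coefficients, homogeneity, Euler's identity and transvectants of lists *)

Section Coefficients.
Variable k : fieldType.
Implicit Types (s t : seq k) (p : {mpoly k[2]}).

Lemma bmonE a b (i : 'I_2) : bmon a b i = if i == 0 then a else b.
Proof.
by rewrite /bmon mnmDE !mulmnE !mnm1E; case: (ord2_cases i) => ->;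
  rewrite ?mul1n ?mul0n ?addn0.
Qed.

Lemma mdeg_bin (m : 'X_{1..2}) : mdeg m = (m 0%R + m 1%R)%N.
Proof.
rewrite mdegE !big_ord_recl big_ord0 addn0.
by rewrite (_ : lift _ _ = 1) //; apply: val_inj.
Qed.

Lemma mpolyX_bmon (m : 'X_{1..2}) :
  'X_[m] = 'X_0 ^+ m 0 * 'X_1 ^+ m 1 :> {mpoly k[2]}.
Proof.
rewrite mpolyXE_id !big_ord_recl big_ord0 mulr1.
by rewrite (_ : lift _ _ = 1) //; apply: val_inj.
Qed.

Lemma mcoeffX1M p a : ('X_1 * p)@_(bmon a 0) = 0.
Proof.
rewrite [p]mpolyE mulr_sumr raddf_sum /= big1 // => m _.
rewrite -scalerAr -mpolyXD mcoeffZ mcoeffX [_ == _]negbTE ?mulr0 //.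
by apply/eqP => /mnmP /(_ 1); rewrite mnmDE mnm1E bmonE.
Qed.

Lemma mcoeff_bform s a b : (a + b).+1 = size s -> (bform s)@_(bmon a b) = s`_b.
Proof.
elim: s a b => [|c s IH] a b //= [eqs].
rewrite mcoeffD mcoeffZ mcoeffXn; case: b eqs => [|b] eqs.
  rewrite mcoeffX1M addr0 -eqs addn0 [_ == _](_ : _ = true) ?mulr1 //.
  by apply/eqP/mnmP => i; rewrite bmonE mulmnE mnm1E;
    case: (ord2_cases i) => ->; rewrite ?mul1n ?mul0n.
rewrite [_ == _]negbTE ?mulr0 ?add0r; last first.
  by apply/eqP => /mnmP /(_ 1); rewrite mulmnE mnm1E bmonE.
have -> : bmon a b.+1 = (U_(1%R) + bmon a b)%MM.
  by apply/mnmP => i; rewrite mnmDE mnm1E !bmonE; case: (ord2_cases i) => ->.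
by rewrite mulrC mcoeffMX IH //= -eqs addnS.
Qed.

Lemma bcoef_bform n s i : (i <= n)%N -> size s = n.+1 -> bcoef n (bform s) i = s`_i.
Proof. by move=> lein eqs; rewrite /bcoef mcoeff_bform // subnK. Qed.

Lemma bform_nil0 n : bform (nseq n 0) = 0 :> {mpoly k[2]}.
Proof. by elim: n => //= n ->; rewrite scale0r mulr0 addr0. Qed.

Lemma bform_monomial a b :
  bform (nseq b 0 ++ 1 :: nseq a 0) = 'X_0 ^+ a * 'X_1 ^+ b :> {mpoly k[2]}.
Proof.
elim: b => [|b IH]; first by rewrite /= bform_nil0 mulr0 addr0 scale1r size_nseq mulr1.
by rewrite [_ ++ _]/= bform0s IH exprS mulrCA.
Qed.

Lemma homog_bform n p : p \is n.-homog -> exists2 s, size s = n.+1 & p = bform s.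
Proof.
move=> /dhomogP hp; rewrite [p]mpolyE big_seq.
elim/big_ind: _ => [|p1 p2 [s1 s1n ->] [s2 s2n ->]|m /hp /= dm].
- by exists (nseq n.+1 0); rewrite ?size_nseq // bform_nil0.
- by exists (ladd s1 s2); rewrite ?size_ladd ?s1n ?s2n ?maxnn // bform_add ?s1n.
exists [seq p@_m * c | c <- nseq (m 1) 0 ++ 1 :: nseq (m 0) 0].
  rewrite size_map size_cat /= !size_nseq addnS -dm mdeg_bin.
  by rewrite addnC.
by rewrite bform_scale bform_monomial mpolyX_bmon.
Qed.

Lemma bform_homog s n : size s = n.+1 -> bform s \is n.-homog.
Proof.
elim: s n => [|a s IH] n //= [eqn].
apply: dhomogD.
  by rewrite dhomogZ // mpolyXn dhomogX /= mdegMn mdeg1 mul1n eqn.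
case: s eqn IH => [|b s] eqn IH; first by rewrite mulr0 dhomog0.
by rewrite -eqn -[size _]/(1 + size s)%N dhomogM ?IH // dhomogX /= mdeg1.
Qed.

Lemma lin_subst_homog M n p : p \is n.-homog -> lin_subst M p \is n.-homog.
Proof.
move=> /dhomogP hp; rewrite [p]mpolyE big_seq /lin_subst raddf_sum /=.
apply: (big_ind (fun q : {mpoly k[2]} => q \is n.-homog)) => [|p1 p2|m /hp /= dm].
- exact: dhomog0.
- exact: dhomogD.
have homX i : lin_subst M 'X_i \is 1.-homog.
  by rewrite lin_substX dhomogD // dhomogZ // dhomogX /= mdeg1.
rewrite comp_mpolyZ dhomogZ // mpolyX_bmon -/(lin_subst M _).
rewrite lin_substM !lin_substXn -dm mdeg_bin dhomogM //.
  by have := dhomogMn (m 0%R) (homX 0); rewrite mul1n.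
by have := dhomogMn (m 1%R) (homX 1); rewrite mul1n.
Qed.

Lemma euler_bform s :
  'X_0 * (bform s)^`M(0) + 'X_1 * (bform s)^`M(1) = (size s).-1%:R *: bform s.
Proof.
elim: s => [|a s IH]; first by rewrite /= !mderiv0 !mulr0 addr0 scaler0.
rewrite /= !mderivD !mderivZ !mderivX0 !mderivM !mderivXU /=.
rewrite mpolyC0 mul0r add0r scale0r scaler0 add0r mpolyC1 mul1r mulrDr scalerDr.

have -> : 'X_0 * (a *: ((size s)%:R *: 'X_0 ^+ (size s).-1)) =
    (size s)%:R *: (a *: 'X_0 ^+ size s) :> {mpoly k[2]}.
  rewrite -!scalerAr; case: (size s) => [|n]; first by rewrite !scale0r scaler0.
  by rewrite -exprS scalerA mulrC -scalerA.
(* The truncated predecessor is harmless: for the empty list the form itself is zero. *)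
have -> : (size s)%:R *: ('X_1 * bform s) =
    'X_1 * bform s + 'X_1 * ((size s).-1%:R *: bform s).
  case: s {IH} => [|b s]; first by rewrite /= !mulr0 scaler0 mulr0 addr0.
  rewrite [size _]/= mulrS scalerDl scale1r -scalerAr.
  by rewrite [_.+1.-1]/=.
rewrite -IH !mulrDr -!addrA; congr (_ + _); rewrite addrCA; congr (_ + _).
by rewrite mulrCA.
Qed.

Lemma euler n p : p \is n.-homog -> 'X_0 * p^`M(0) + 'X_1 * p^`M(1) = n%:R *: p.
Proof. by case/homog_bform => s sn ->; rewrite euler_bform sn. Qed.

Hypothesis char0 : [pchar k] =i pred0.

Lemma natr_neq0 n : (n.+1%:R != 0 :> k).
Proof. by move/pcharf0P: char0 => ->. Qed.

(** The constant term of $\partial_x^a\partial_y^b p$ is $a!\,b!$ times one coefficient of $p$. The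
    factor $\binom mj\,((m-j)!\,j!)^2/m!^2$ then collapses to $1/\binom mj$. *)
Lemma full_transvectantE m A B : full_transvectant m A B =
  \sum_(j < m.+1) (-1) ^+ j / 'C(m, j)%:R * bcoef m A j * bcoef m B (m - j) :> k.
Proof.
rewrite /full_transvectant /transvectant mcoeffZ raddf_sum mulr_sumr /=.
apply: eq_bigr => j _; have lejm : (j <= m)%N by rewrite -ltnS.
have coef0 a b (p : {mpoly k[2]}) :
    (mderivm (bmon a b) p)@_0 = a`!%:R * b`!%:R * p@_(bmon a b).
  rewrite mcoeff_mderivm addm0 !big_ord_recl big_ord0 muln1.
  rewrite (_ : lift _ _ = 1); last exact: val_inj.
  by rewrite !bmonE !ffactnn /= -natrM mulr_natl.
rewrite mcoeffZ rmorphM /= !coef0 /bcoef subKn // subnn fact0.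
have fm := bin_fact lejm.
have nz n : n`!%:R != 0 :> k by rewrite -(prednK (fact_gt0 n)) natr_neq0.
have nzC : 'C(m, j)%:R != 0 :> k.
  by rewrite -(prednK (_ : 0 < 'C(m, j))%N) ?bin_gt0 // natr_neq0.
rewrite -fm !natrM.
by field; rewrite nzC !nz.
Qed.

Lemma ring_of_bin_of_nat n : ring_of_N k (bin_of_nat n) = n%:R.
Proof. by rewrite ring_of_NE bin_of_natK. Qed.

(* In binary, because [field] does not evaluate large unary literals. *)
Definition bin_row m := [seq bin_of_nat 'C(m, j) | j <- iota 0 m.+1].

(** Subtracting the recursive call produces the alternating signs. The second list is meant to be
    the reversed coefficient list. *)
Fixpoint lfull (w : seq BinNums.N) s t : k :=
  match w, s, t with
  | n :: w', a :: s', b :: t' => a * b / ring_of_N k n - lfull w' s' t'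
  | _, _, _ => 0
  end.

Lemma lfullE w s t : size s = size w -> size t = size w ->
  lfull w s t =
  \sum_(j < size w) (-1) ^+ j / ring_of_N k (nth BinNums.N0 w j) * s`_j * t`_j.
Proof.
elim: w s t => [|n w IH] [|a s] [|b t] //=; first by rewrite big_ord0.
move=> [eqs] [eqt]; rewrite big_ord_recl IH //= expr0 -sumrN.
congr (_ + _); first by rewrite mul1r mulrC mulrA.
by apply: eq_bigr => j _; rewrite /bump add1n exprS mulN1r !mulNr.
Qed.

Lemma full_transvectant_bform m s t : size s = m.+1 -> size t = m.+1 ->
  full_transvectant m (bform s) (bform t) = lfull (bin_row m) s (rev t).
Proof.
move=> eqs eqt; rewrite lfullE ?size_rev ?size_map ?size_iota //.
rewrite full_transvectantE; apply: eq_bigr => j _.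
have lejm : (j <= m)%N by rewrite -ltnS.
rewrite (nth_map 0%N) ?size_iota // nth_iota // ring_of_bin_of_nat.
by rewrite !bcoef_bform ?leq_subr // nth_rev ?eqt // subSS.
Qed.

(** The quotients of factorials are falling factorials; [c] and [d] are their values, supplied as
    small literals and checked by computation. *)
Lemma transvectant_bform c d m n r s t : (r <= m)%N -> (r <= n)%N ->
  m ^_ r = c -> n ^_ r = d -> transvectant m n r (bform s) (bform t) =
  bform [seq (c%:R * d%:R)^-1 * a | a <- lomega r s t].
Proof.
move=> lerm lern <- <-; rewrite transvectantE omega_bform bform_scale.
have nz i : i`!%:R != 0 :> k by rewrite -(prednK (fact_gt0 i)) natr_neq0.
have nzf i j : (j <= i)%N -> (i ^_ j)%:R != 0 :> k.
  by move=> leji; rewrite -(prednK (_ : 0 < i ^_ j)%N) ?ffact_gt0 // natr_neq0.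
congr (_ *: _); rewrite -!(ffact_fact lerm) -!(ffact_fact lern) !natrM.
by field; rewrite !nzf // !nz.
Qed.

End Coefficients.

(** * The invariants at G = x^3 + y^3 *)

Lemma bin_row2 : bin_row 2 =
  [:: 1%num; 2%num; 1%num].
Proof. by vm_compute. Qed.

Lemma bin_row3 : bin_row 3 =
  [:: 1%num; 3%num; 3%num; 1%num].
Proof. by vm_compute. Qed.

Lemma bin_row5 : bin_row 5 =
  [:: 1%num; 5%num; 10%num; 10%num; 5%num; 1%num].
Proof. by vm_compute. Qed.

Lemma bin_row6 : bin_row 6 =
  [:: 1%num; 6%num; 15%num; 20%num; 15%num; 6%num; 1%num].
Proof. by vm_compute. Qed.

Lemma bin_row9 : bin_row 9 =
  [:: 1%num; 9%num; 36%num; 84%num; 126%num; 126%num; 84%num; 36%num; 9%num;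
  1%num].
Proof. by vm_compute. Qed.

Lemma bin_row15 : bin_row 15 =
  [:: 1%num; 15%num; 105%num; 455%num; 1365%num; 3003%num; 5005%num; 6435%num;
  6435%num; 5005%num; 3003%num; 1365%num; 455%num; 105%num; 15%num; 1%num].
Proof. by vm_compute. Qed.

Section NormalForm.
Variable k : fieldType.
Hypothesis char0 : [pchar k] =i pred0.
Variables a0 a1 a2 a3 a4 a5 : k.

Let F := bform [:: a0; 5%:R * a1; 10%:R * a2; 10%:R * a3; 5%:R * a4; a5].
Let G : {mpoly k[2]} := bform [:: 1; 0; 0; 1].

Let nz := natr_neq0 char0.

Lemma cov_h_nf : cov_h G = bform [:: 0; 2%:R; 0].
Proof.
rewrite /cov_h (transvectant_bform char0 (c := 6) (d := 6)
  (m := 3) (n := 3) (r := 2) _ _ isT isT erefl erefl).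
congr bform; rewrite /=.
by congr [:: _; _; _]; field; rewrite ?oner_neq0 ?nz.
Qed.

Lemma cov_q_nf : cov_q G = bform [:: 1; 0; 0; - 1].
Proof.
rewrite /cov_q cov_h_nf (transvectant_bform char0 (c := 3) (d := 2)
  (m := 3) (n := 2) (r := 1) _ _ isT isT erefl erefl).
congr bform; rewrite /=.
by congr [:: _; _; _; _]; field; rewrite ?oner_neq0 ?nz.
Qed.

Lemma cov_i_nf : cov_i F = bform [::
      2%:R * a0 * a4 - 8%:R * a1 * a3 + 6%:R * a2 ^+ 2;
      2%:R * a0 * a5 - 6%:R * a1 * a4 + 4%:R * a2 * a3;
      2%:R * a1 * a5 - 8%:R * a2 * a4 + 6%:R * a3 ^+ 2].
Proof.
rewrite /cov_i (transvectant_bform char0 (c := 120) (d := 120)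
  (m := 5) (n := 5) (r := 4) _ _ isT isT erefl erefl).
congr bform; rewrite /=.
by congr [:: _; _; _]; field; rewrite ?oner_neq0 ?nz.
Qed.

Lemma cov_H_nf : cov_H F = bform [::
      2%:R * a0 * a2 - 2%:R * a1 ^+ 2;
      6%:R * a0 * a3 - 6%:R * a1 * a2;
      6%:R * a0 * a4 + 6%:R * a1 * a3 - 12%:R * a2 ^+ 2;
      2%:R * a0 * a5 + 14%:R * a1 * a4 - 16%:R * a2 * a3;
      6%:R * a1 * a5 + 6%:R * a2 * a4 - 12%:R * a3 ^+ 2;
      6%:R * a2 * a5 - 6%:R * a3 * a4;
      2%:R * a3 * a5 - 2%:R * a4 ^+ 2].
Proof.
rewrite /cov_H (transvectant_bform char0 (c := 20) (d := 20)
  (m := 5) (n := 5) (r := 2) _ _ isT isT erefl erefl).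
congr bform; rewrite /=.
by congr [:: _; _; _; _; _; _; _]; field; rewrite ?oner_neq0 ?nz.
Qed.

Lemma cov_t_nf : cov_t F = bform [::
      a0 ^+ 2 * a3 - 3%:R * a0 * a1 * a2 + 2%:R * a1 ^+ 3;
      2%:R * a0 ^+ 2 * a4 + a0 * a1 * a3 - 12%:R * a0 * a2 ^+ 2
      + 9%:R * a1 ^+ 2 * a2;
      a0 ^+ 2 * a5 + 11%:R * a0 * a1 * a4 - 34%:R * a0 * a2 * a3
      + 16%:R * a1 ^+ 2 * a3 + 6%:R * a1 * a2 ^+ 2;
      7%:R * a0 * a1 * a5 - 8%:R * a0 * a2 * a4 - 34%:R * a0 * a3 ^+ 2
      + 29%:R * a1 ^+ 2 * a4 - 2%:R * a1 * a2 * a3 + 8%:R * a2 ^+ 3;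
      5%:R * a0 * a2 * a5 - 40%:R * a0 * a3 * a4 + 16%:R * a1 ^+ 2 * a5
      + 47%:R * a1 * a2 * a4 - 44%:R * a1 * a3 ^+ 2 + 16%:R * a2 ^+ 2 * a3;
      - 5%:R * a0 * a3 * a5 - 16%:R * a0 * a4 ^+ 2 + 40%:R * a1 * a2 * a5
      - 47%:R * a1 * a3 * a4 + 44%:R * a2 ^+ 2 * a4 - 16%:R * a2 * a3 ^+ 2;
      - 7%:R * a0 * a4 * a5 + 8%:R * a1 * a3 * a5 - 29%:R * a1 * a4 ^+ 2
      + 34%:R * a2 ^+ 2 * a5 + 2%:R * a2 * a3 * a4 - 8%:R * a3 ^+ 3;
      - a0 * a5 ^+ 2 - 11%:R * a1 * a4 * a5 + 34%:R * a2 * a3 * a5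
      - 16%:R * a2 * a4 ^+ 2 - 6%:R * a3 ^+ 2 * a4;
      - 2%:R * a1 * a5 ^+ 2 - a2 * a4 * a5 + 12%:R * a3 ^+ 2 * a5
      - 9%:R * a3 * a4 ^+ 2;
      - a2 * a5 ^+ 2 + 3%:R * a3 * a4 * a5 - 2%:R * a4 ^+ 3].
Proof.
rewrite /cov_t cov_H_nf (transvectant_bform char0 (c := 5) (d := 6)
  (m := 5) (n := 6) (r := 1) _ _ isT isT erefl erefl).
congr bform; rewrite /=.
by congr [:: _; _; _; _; _; _; _; _; _; _]; field; rewrite ?oner_neq0 ?nz.
Qed.

Lemma cov_c35_nf : cov_c35 F = bform [::
      - a0 ^+ 2 * a5 + 5%:R * a0 * a1 * a4 - 2%:R * a0 * a2 * a3
      - 8%:R * a1 ^+ 2 * a3 + 6%:R * a1 * a2 ^+ 2;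
      - 5%:R * a0 * a1 * a5 + 16%:R * a0 * a2 * a4 - 6%:R * a0 * a3 ^+ 2
      + 9%:R * a1 ^+ 2 * a4 - 38%:R * a1 * a2 * a3 + 24%:R * a2 ^+ 3;
      - 2%:R * a0 * a2 * a5 + 12%:R * a0 * a3 * a4 - 8%:R * a1 ^+ 2 * a5
      + 38%:R * a1 * a2 * a4 - 72%:R * a1 * a3 ^+ 2 + 32%:R * a2 ^+ 2 * a3;
      2%:R * a0 * a3 * a5 + 8%:R * a0 * a4 ^+ 2 - 12%:R * a1 * a2 * a5
      - 38%:R * a1 * a3 * a4 + 72%:R * a2 ^+ 2 * a4 - 32%:R * a2 * a3 ^+ 2;
      5%:R * a0 * a4 * a5 - 16%:R * a1 * a3 * a5 - 9%:R * a1 * a4 ^+ 2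
      + 6%:R * a2 ^+ 2 * a5 + 38%:R * a2 * a3 * a4 - 24%:R * a3 ^+ 3;
      a0 * a5 ^+ 2 - 5%:R * a1 * a4 * a5 + 2%:R * a2 * a3 * a5
      + 8%:R * a2 * a4 ^+ 2 - 6%:R * a3 ^+ 2 * a4].
Proof.
rewrite /cov_c35 cov_i_nf (transvectant_bform char0 (c := 2) (d := 5)
  (m := 2) (n := 5) (r := 1) _ _ isT isT erefl erefl).
congr bform; rewrite /=.
by congr [:: _; _; _; _; _; _]; field; rewrite ?oner_neq0 ?nz.
Qed.

Lemma cov_c33_nf : cov_c33 F = bform [::
      - 6%:R * a0 * a2 * a4 + 6%:R * a0 * a3 ^+ 2 + 6%:R * a1 ^+ 2 * a4
      - 12%:R * a1 * a2 * a3 + 6%:R * a2 ^+ 3;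
      - 6%:R * a0 * a2 * a5 + 6%:R * a0 * a3 * a4 + 6%:R * a1 ^+ 2 * a5
      - 6%:R * a1 * a2 * a4 - 6%:R * a1 * a3 ^+ 2 + 6%:R * a2 ^+ 2 * a3;
      - 6%:R * a0 * a3 * a5 + 6%:R * a0 * a4 ^+ 2 + 6%:R * a1 * a2 * a5
      - 6%:R * a1 * a3 * a4 - 6%:R * a2 ^+ 2 * a4 + 6%:R * a2 * a3 ^+ 2;
      - 6%:R * a1 * a3 * a5 + 6%:R * a1 * a4 ^+ 2 + 6%:R * a2 ^+ 2 * a5
      - 12%:R * a2 * a3 * a4 + 6%:R * a3 ^+ 3].
Proof.
rewrite /cov_c33 cov_i_nf (transvectant_bform char0 (c := 2) (d := 20)
  (m := 2) (n := 5) (r := 2) _ _ isT isT erefl erefl).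
congr bform; rewrite /=.
by congr [:: _; _; _; _]; field; rewrite ?oner_neq0 ?nz.
Qed.

Lemma prod_Gh_nf : G * cov_h G = bform
  [:: 0; 2%:R; 0; 0; 2%:R; 0].
Proof.
rewrite ?cov_h_nf ?cov_q_nf -?bform_exp -?bform_mul; congr bform; rewrite /=.
by congr [:: _; _; _; _; _; _]; ring.
Qed.

Lemma prod_hq_nf : cov_h G * cov_q G = bform
  [:: 0; 2%:R; 0; 0; - 2%:R; 0].
Proof.
rewrite ?cov_h_nf ?cov_q_nf -?bform_exp -?bform_mul; congr bform; rewrite /=.
by congr [:: _; _; _; _; _; _]; ring.
Qed.

Lemma prod_GG_nf : G ^+ 2 = bform
  [:: 1; 0; 0; 2%:R; 0; 0; 1].
Proof.
rewrite ?cov_h_nf ?cov_q_nf -?bform_exp -?bform_mul; congr bform; rewrite /=.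
by congr [:: _; _; _; _; _; _; _]; ring.
Qed.

Lemma prod_Gq_nf : G * cov_q G = bform
  [:: 1; 0; 0; 0; 0; 0; - 1].
Proof.
rewrite ?cov_h_nf ?cov_q_nf -?bform_exp -?bform_mul; congr bform; rewrite /=.
by congr [:: _; _; _; _; _; _; _]; ring.
Qed.

Lemma prod_qq_nf : cov_q G ^+ 2 = bform
  [:: 1; 0; 0; - 2%:R; 0; 0; 1].
Proof.
rewrite ?cov_h_nf ?cov_q_nf -?bform_exp -?bform_mul; congr bform; rewrite /=.
by congr [:: _; _; _; _; _; _; _]; ring.
Qed.

Lemma prod_G3_nf : G ^+ 3 = bform
  [:: 1; 0; 0; 3%:R; 0; 0; 3%:R; 0; 0; 1].
Proof.
rewrite ?cov_h_nf ?cov_q_nf -?bform_exp -?bform_mul; congr bform; rewrite /=.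
by congr [:: _; _; _; _; _; _; _; _; _; _]; ring.
Qed.

Lemma prod_GGq_nf : G ^+ 2 * cov_q G = bform
  [:: 1; 0; 0; 1; 0; 0; - 1; 0; 0; - 1].
Proof.
rewrite ?cov_h_nf ?cov_q_nf -?bform_exp -?bform_mul; congr bform; rewrite /=.
by congr [:: _; _; _; _; _; _; _; _; _; _]; ring.
Qed.

Lemma prod_G5_nf : G ^+ 5 = bform
  [:: 1; 0; 0; 5%:R; 0; 0; 10%:R; 0; 0; 10%:R; 0; 0; 5%:R; 0; 0; 1].
Proof.
rewrite ?cov_h_nf ?cov_q_nf -?bform_exp -?bform_mul; congr bform; rewrite /=.
by congr [:: _; _; _; _; _; _; _; _; _; _; _; _; _; _; _; _]; ring.
Qed.

Lemma prod_G4q_nf : G ^+ 4 * cov_q G = bform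
  [:: 1; 0; 0; 3%:R; 0; 0; 2%:R; 0; 0; - 2%:R; 0; 0; - 3%:R; 0; 0; - 1].
Proof.
rewrite ?cov_h_nf ?cov_q_nf -?bform_exp -?bform_mul; congr bform; rewrite /=.
by congr [:: _; _; _; _; _; _; _; _; _; _; _; _; _; _; _; _]; ring.
Qed.

Lemma inv_D_nf : inv_D G = - 2%:R.
Proof.
rewrite /inv_D cov_h_nf (full_transvectant_bform char0); [|by []|by []].
rewrite bin_row2 /=.
by field; rewrite ?oner_neq0 ?nz.
Qed.

Lemma inv_A_nf : inv_A F G =
  - 2%:R * a1 + 2%:R * a4.
Proof.
rewrite /inv_A prod_Gh_nf.
rewrite (full_transvectant_bform char0); [|by []|by []].
by rewrite bin_row5 /=; field; rewrite ?oner_neq0 ?nz.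
Qed.

Lemma inv_L_nf : inv_L F G =
  2%:R * a1 + 2%:R * a4.
Proof.
rewrite /inv_L prod_hq_nf.
rewrite (full_transvectant_bform char0); [|by []|by []].
by rewrite bin_row5 /=; field; rewrite ?oner_neq0 ?nz.
Qed.

Lemma inv_B1_nf : inv_B1 F G =
  - 2%:R * a0 * a5 + 6%:R * a1 * a4 - 4%:R * a2 * a3.
Proof.
rewrite /inv_B1 cov_h_nf cov_i_nf.
rewrite (full_transvectant_bform char0); [|by []|by []].
by rewrite bin_row2 /=; field; rewrite ?oner_neq0 ?nz.
Qed.

Lemma inv_B2_nf : inv_B2 F G =
  2%:R * a0 * a2 - 1%:R / 5%:R * a0 * a5 - 2%:R * a1 ^+ 2
  - 7%:R / 5%:R * a1 * a4 + 8%:R / 5%:R * a2 * a3 + 2%:R * a3 * a5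
  - 2%:R * a4 ^+ 2.
Proof.
rewrite /inv_B2 prod_GG_nf cov_H_nf.
rewrite (full_transvectant_bform char0); [|by []|by []].
by rewrite bin_row6 /=; field; rewrite ?oner_neq0 ?nz.
Qed.

Lemma inv_M_nf : inv_M F G =
  - 2%:R * a0 * a2 + 2%:R * a1 ^+ 2 + 2%:R * a3 * a5 - 2%:R * a4 ^+ 2.
Proof.
rewrite /inv_M prod_Gq_nf cov_H_nf.
rewrite (full_transvectant_bform char0); [|by []|by []].
by rewrite bin_row6 /=; field; rewrite ?oner_neq0 ?nz.
Qed.

Lemma inv_N_nf : inv_N F G =
  2%:R * a0 * a2 + 1%:R / 5%:R * a0 * a5 - 2%:R * a1 ^+ 2
  + 7%:R / 5%:R * a1 * a4 - 8%:R / 5%:R * a2 * a3 + 2%:R * a3 * a5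
  - 2%:R * a4 ^+ 2.
Proof.
rewrite /inv_N prod_qq_nf cov_H_nf.
rewrite (full_transvectant_bform char0); [|by []|by []].
by rewrite bin_row6 /=; field; rewrite ?oner_neq0 ?nz.
Qed.

Lemma inv_R_nf : inv_R F G =
  - 6%:R * a0 * a2 * a4 + 6%:R * a0 * a3 ^+ 2 + 6%:R * a1 ^+ 2 * a4
  - 12%:R * a1 * a2 * a3 + 6%:R * a1 * a3 * a5 - 6%:R * a1 * a4 ^+ 2
  + 6%:R * a2 ^+ 3 - 6%:R * a2 ^+ 2 * a5 + 12%:R * a2 * a3 * a4
  - 6%:R * a3 ^+ 3.
Proof.
rewrite /inv_R cov_c33_nf.
rewrite (full_transvectant_bform char0); [|by []|by []].
by rewrite bin_row3 /=; field; rewrite ?oner_neq0 ?nz.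
Qed.

Lemma inv_S1_nf : inv_S1 F G =
  6%:R * a0 * a2 * a4 - 6%:R * a0 * a3 ^+ 2 - 6%:R * a1 ^+ 2 * a4
  + 12%:R * a1 * a2 * a3 + 6%:R * a1 * a3 * a5 - 6%:R * a1 * a4 ^+ 2
  - 6%:R * a2 ^+ 3 - 6%:R * a2 ^+ 2 * a5 + 12%:R * a2 * a3 * a4
  - 6%:R * a3 ^+ 3.
Proof.
rewrite /inv_S1 cov_c33_nf cov_q_nf.
rewrite (full_transvectant_bform char0); [|by []|by []].
by rewrite bin_row3 /=; field; rewrite ?oner_neq0 ?nz.
Qed.

Lemma inv_S2_nf : inv_S2 F G =
  2%:R * a0 * a1 * a5 - 32%:R / 5%:R * a0 * a2 * a4
  + 12%:R / 5%:R * a0 * a3 ^+ 2 + 2%:R * a0 * a4 * a5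
  - 18%:R / 5%:R * a1 ^+ 2 * a4 + 76%:R / 5%:R * a1 * a2 * a3
  - 32%:R / 5%:R * a1 * a3 * a5 - 18%:R / 5%:R * a1 * a4 ^+ 2
  - 48%:R / 5%:R * a2 ^+ 3 + 12%:R / 5%:R * a2 ^+ 2 * a5
  + 76%:R / 5%:R * a2 * a3 * a4 - 48%:R / 5%:R * a3 ^+ 3.
Proof.
rewrite /inv_S2 prod_Gh_nf cov_c35_nf.
rewrite (full_transvectant_bform char0); [|by []|by []].
by rewrite bin_row5 /=; field; rewrite ?oner_neq0 ?nz.
Qed.

Lemma inv_S3_nf : inv_S3 F G =
  a0 ^+ 2 * a3 - 3%:R * a0 * a1 * a2 - 1%:R / 4%:R * a0 * a1 * a5
  + 2%:R / 7%:R * a0 * a2 * a4 + 17%:R / 14%:R * a0 * a3 ^+ 2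
  - 1%:R / 4%:R * a0 * a4 * a5 + 2%:R * a1 ^+ 3 - 29%:R / 28%:R * a1 ^+ 2 * a4
  + 1%:R / 14%:R * a1 * a2 * a3 + 2%:R / 7%:R * a1 * a3 * a5
  - 29%:R / 28%:R * a1 * a4 ^+ 2 - 2%:R / 7%:R * a2 ^+ 3
  + 17%:R / 14%:R * a2 ^+ 2 * a5 + 1%:R / 14%:R * a2 * a3 * a4 + a2 * a5 ^+ 2
  - 2%:R / 7%:R * a3 ^+ 3 - 3%:R * a3 * a4 * a5 + 2%:R * a4 ^+ 3.
Proof.
rewrite /inv_S3 prod_G3_nf cov_t_nf.
rewrite (full_transvectant_bform char0); [|by []|by []].
by rewrite bin_row9 /=; field; rewrite ?oner_neq0 ?nz.
Qed.

Lemma inv_T1_nf : inv_T1 F G =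
  - 2%:R * a0 * a1 * a5 + 32%:R / 5%:R * a0 * a2 * a4
  - 12%:R / 5%:R * a0 * a3 ^+ 2 + 2%:R * a0 * a4 * a5
  + 18%:R / 5%:R * a1 ^+ 2 * a4 - 76%:R / 5%:R * a1 * a2 * a3
  - 32%:R / 5%:R * a1 * a3 * a5 - 18%:R / 5%:R * a1 * a4 ^+ 2
  + 48%:R / 5%:R * a2 ^+ 3 + 12%:R / 5%:R * a2 ^+ 2 * a5
  + 76%:R / 5%:R * a2 * a3 * a4 - 48%:R / 5%:R * a3 ^+ 3.
Proof.
rewrite /inv_T1 prod_hq_nf cov_c35_nf.
rewrite (full_transvectant_bform char0); [|by []|by []].
by rewrite bin_row5 /=; field; rewrite ?oner_neq0 ?nz.
Qed.

Lemma inv_T2_nf : inv_T2 F G =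
  - a0 ^+ 2 * a3 + 3%:R * a0 * a1 * a2 + 1%:R / 12%:R * a0 * a1 * a5
  - 2%:R / 21%:R * a0 * a2 * a4 - 17%:R / 42%:R * a0 * a3 ^+ 2
  - 1%:R / 12%:R * a0 * a4 * a5 - 2%:R * a1 ^+ 3
  + 29%:R / 84%:R * a1 ^+ 2 * a4 - 1%:R / 42%:R * a1 * a2 * a3
  + 2%:R / 21%:R * a1 * a3 * a5 - 29%:R / 84%:R * a1 * a4 ^+ 2
  + 2%:R / 21%:R * a2 ^+ 3 + 17%:R / 42%:R * a2 ^+ 2 * a5
  + 1%:R / 42%:R * a2 * a3 * a4 + a2 * a5 ^+ 2 - 2%:R / 21%:R * a3 ^+ 3
  - 3%:R * a3 * a4 * a5 + 2%:R * a4 ^+ 3.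
Proof.
rewrite /inv_T2 prod_GGq_nf cov_t_nf.
rewrite (full_transvectant_bform char0); [|by []|by []].
by rewrite bin_row9 /=; field; rewrite ?oner_neq0 ?nz.
Qed.

Lemma inv_T3_nf : inv_T3 F G =
  a0 ^+ 3 - 30%:R / 91%:R * a0 ^+ 2 * a3 - 300%:R / 91%:R * a0 * a1 * a2
  + 60%:R / 1001%:K * a0 * a1 * a5 + 600%:R / 1001%:K * a0 * a2 * a4
  + 600%:R / 1001%:K * a0 * a3 ^+ 2 - 60%:R / 1001%:K * a0 * a4 * a5
  - 125%:R / 91%:R * a1 ^+ 3 + 750%:R / 1001%:K * a1 ^+ 2 * a4
  + 6000%:K / 1001%:K * a1 * a2 * a3 - 600%:R / 1001%:K * a1 * a3 * a5
  - 750%:R / 1001%:K * a1 * a4 ^+ 2 + 2000%:K / 1001%:K * a2 ^+ 3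
  - 600%:R / 1001%:K * a2 ^+ 2 * a5 - 6000%:K / 1001%:K * a2 * a3 * a4
  + 30%:R / 91%:R * a2 * a5 ^+ 2 - 2000%:K / 1001%:K * a3 ^+ 3
  + 300%:R / 91%:R * a3 * a4 * a5 + 125%:R / 91%:R * a4 ^+ 3 - a5 ^+ 3.
Proof.
rewrite /inv_T3 prod_G5_nf -bform_exp.
rewrite (full_transvectant_bform char0); [|by []|by []].
(* Ten of the sixteen coefficients of [G ^+ 5] vanish; their products are discarded before [field]
   runs. *)
by rewrite bin_row15 /= !(mulr0, mul0r); field; rewrite ?oner_neq0 ?nz.
Qed.

Lemma inv_W_nf : inv_W F G =
  - a0 ^+ 3 + 18%:R / 91%:R * a0 ^+ 2 * a3 + 180%:R / 91%:R * a0 * a1 * a2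
  - 12%:R / 1001%:K * a0 * a1 * a5 - 120%:R / 1001%:K * a0 * a2 * a4
  - 120%:R / 1001%:K * a0 * a3 ^+ 2 - 12%:R / 1001%:K * a0 * a4 * a5
  + 75%:R / 91%:R * a1 ^+ 3 - 150%:R / 1001%:K * a1 ^+ 2 * a4
  - 1200%:K / 1001%:K * a1 * a2 * a3 - 120%:R / 1001%:K * a1 * a3 * a5
  - 150%:R / 1001%:K * a1 * a4 ^+ 2 - 400%:R / 1001%:K * a2 ^+ 3
  - 120%:R / 1001%:K * a2 ^+ 2 * a5 - 1200%:K / 1001%:K * a2 * a3 * a4
  + 18%:R / 91%:R * a2 * a5 ^+ 2 - 400%:R / 1001%:K * a3 ^+ 3
  + 180%:R / 91%:R * a3 * a4 * a5 + 75%:R / 91%:R * a4 ^+ 3 - a5 ^+ 3.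
Proof.
rewrite /inv_W prod_G4q_nf -bform_exp.
rewrite (full_transvectant_bform char0); [|by []|by []].
by rewrite bin_row15 /= !(mulr0, mul0r); field; rewrite ?oner_neq0 ?nz.
Qed.

Definition inv_nf := (inv_D_nf, inv_A_nf, inv_L_nf, inv_B1_nf, inv_B2_nf,
  inv_M_nf, inv_N_nf, inv_R_nf, inv_S1_nf, inv_S2_nf, inv_S3_nf, inv_T1_nf,
  inv_T2_nf, inv_T3_nf, inv_W_nf).

(** * The numerators in the coordinates [p] and [p'] *)

Let p := a0 + 98%:R * a3.
Let p' := a5 + 98%:R * a2.

Lemma P1_nf : P1 F G = 1400%:K * (a4 - a1).
Proof. by rewrite /P1 !inv_nf /p /p' /=; field; rewrite ?oner_neq0 ?nz. Qed.

Lemma P2_nf : P2 F G = 20000%:K * (p * p').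
Proof. by rewrite /P2 !inv_nf /p /p' /=; field; rewrite ?oner_neq0 ?nz. Qed.

Lemma P3_nf : P3 F G = 7007000000%:K * (p ^+ 3 - p' ^+ 3).
Proof. by rewrite /P3 !inv_nf /p /p' /=; field; rewrite ?oner_neq0 ?nz. Qed.

Lemma P4_nf : P4 F G = 5644800%:K * (p * a2 + p' * a3) - 119200%:K * (p * p').
Proof. by rewrite /P4 !inv_nf /p /p' /=; field; rewrite ?oner_neq0 ?nz. Qed.

Lemma P5_nf : P5 F G = 41761720000%:K * (p' ^+ 3 - p ^+ 3)
  - 3955311360000%:K * (p' ^+ 2 * a2 - p ^+ 2 * a3).
Proof. by rewrite /P5 !inv_nf /p /p' /=; field; rewrite ?oner_neq0 ?nz. Qed.

Lemma P6_nf : P6 F G = - (70070000000%:K * ((a1 + a4) * (p ^+ 3 + p' ^+ 3))).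
Proof. by rewrite /P6 !inv_nf /p /p' /=; field; rewrite ?oner_neq0 ?nz. Qed.

End NormalForm.

(** * Normalising the cubic *)

Section LinearChanges.
Variable k : fieldType.
Implicit Types (s t : seq k) (a b c d : k).

Definition mx2 a b c d : 'M[k]_2 :=
  \matrix_(i, j) if i == 0 then (if j == 0 then a else b)
                 else (if j == 0 then c else d).

Lemma det_mx2E a b c d : \det (mx2 a b c d) = a * d - b * c.
Proof. by rewrite det_mx2 !mxE. Qed.

Lemma mx2_unit a b c d : (mx2 a b c d \in unitmx) = (a * d - b * c != 0).
Proof. by rewrite unitmxE unitfE det_mx2E. Qed.

Lemma bform_linear a b : bform [:: a; b] = a *: 'X_0 + b *: 'X_1.
Proof. by rewrite /= expr1 expr0 mulr0 addr0 -scalerAr mulr1. Qed.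

Lemma lin_substX0 a b c d : lin_subst (mx2 a b c d) 'X_0 = bform [:: a; b].
Proof. by rewrite lin_substX !mxE bform_linear. Qed.

Lemma lin_substX1 a b c d : lin_subst (mx2 a b c d) 'X_1 = bform [:: c; d].
Proof. by rewrite lin_substX !mxE bform_linear. Qed.

Lemma lin_subst_quadratic a b c d h0 h1 h2 :
  lin_subst (mx2 a b c d) (bform [:: h0; h1; h2]) =
  bform [:: h0 * a ^+ 2 + h1 * a * c + h2 * c ^+ 2;
            2%:R * h0 * a * b + h1 * (a * d + b * c) + 2%:R * h2 * c * d;
            h0 * b ^+ 2 + h1 * b * d + h2 * d ^+ 2].
Proof.
have -> : bform [:: h0; h1; h2] =
    h0 *: ('X_0 * 'X_0) + (h1 *: ('X_0 * 'X_1) + h2 *: ('X_1 * 'X_1)).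
  rewrite /= mulr0 addr0 expr0 expr1 expr2 mulrDr -!scalerAr mulr1.
  by rewrite ['X_1 * 'X_0]mulrC.
rewrite !lin_substD !lin_substZ !lin_substM lin_substX0 lin_substX1.
rewrite -!bform_mul -!bform_scale -!bform_add //.
by congr bform; rewrite /=; congr [:: _; _; _]; ring.
Qed.

Fixpoint ldiag a b s : seq k :=
  if s is c :: s' then c * a ^+ size s' :: [seq b * x | x <- ldiag a b s'] else [::].

Lemma size_ldiag a b s : size (ldiag a b s) = size s.
Proof. by elim: s => //= c s IH; rewrite size_map IH. Qed.

Lemma lin_subst_diag a b s : lin_subst (mx2 a 0 0 b) (bform s) = bform (ldiag a b s).
Proof.
elim: s => [|c s IH]; first exact: comp_mpoly0.
rewrite /= lin_substD lin_substZ lin_substXn lin_substM IH lin_substX0 lin_substX1.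
rewrite bform_scale size_map size_ldiag bform_linear scale0r addr0.
by rewrite bform_linear scale0r add0r exprZn scalerA -scalerAl scalerAr.
Qed.

Lemma bform_rcons s a : bform (rcons s a) = 'X_0 * bform s + a *: 'X_1 ^+ size s.
Proof.
elim: s => [|b s IH]; first by rewrite /= !mulr0 addr0 add0r.
rewrite /= IH size_rcons exprS !mulrDr -scalerAr -addrA mulrCA.
by rewrite -scalerAr exprS.
Qed.

Lemma lin_subst_swap s : lin_subst (mx2 0 1 1 0) (bform s) = bform (rev s).
Proof.
elim: s => [|c s IH]; first exact: comp_mpoly0.
rewrite rev_cons bform_rcons -IH size_rev /= addrC.
rewrite lin_substD lin_substZ lin_substXn lin_substM lin_substX0 lin_substX1.
by rewrite !bform_linear !scale0r !scale1r addr0 add0r.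
Qed.

(** Used to read off coefficients from an equality of normal forms. *)
Lemma bform_inj s t : size s = size t -> bform s = bform t -> s = t.
Proof.
move=> eqst eqf; apply: (@eq_from_nth _ 0) => // i lti.
have lti' : (i <= (size s).-1)%N by case: (size s) lti.
have szs : size s = (size s).-1.+1 by case: (size s) lti.
by rewrite -(bcoef_bform lti' szs) eqf bcoef_bform // -eqst.
Qed.

End LinearChanges.

(** * Normal forms of quadratics and cubics over an algebraically closed field *)

Section Roots.
Variable k : closedFieldType.

Lemma closed_exp_root n (a : k) : (0 < n)%N -> a != 0 ->
  exists2 x, x != 0 & x ^+ n = a.
Proof.
move=> n_gt0 na.
(* The equation solved is $x^n=\sum_{i<n}c_ix^i$ with $c_0=a$ as its only nonzero coefficient. *)
have [x hx] := solve_monicpoly (fun i => if i == 0%N then a else 0) n_gt0.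
have {}hx : x ^+ n = a.
  rewrite hx (bigD1 (Ordinal n_gt0)) //= mulr1 big1 ?addr0 // => i.
  by rewrite -val_eqE /= => /negbTE ->; rewrite mul0r.
exists x => //; apply: contraNneq na => x0.
by rewrite -hx x0 expr0n eqn0Ngt n_gt0.
Qed.

Hypothesis char0 : [pchar k] =i pred0.
Let nz := natr_neq0 char0.

(** The columns of [M] are homogeneous coordinates of the two roots, which are distinct because the
    discriminant is nonzero. *)
Lemma quadratic_normal_form (h0 h1 h2 : k) : h1 ^+ 2 - 4%:R * h0 * h2 != 0 ->
  exists M : 'M[k]_2, exists2 e : k, M \in unitmx &
    lin_subst M (bform [:: h0; h1; h2]) = bform [:: 0; e; 0].
Proof.
have [-> | nh0] := eqVneq h0 0.
  rewrite mulr0 mul0r subr0 expf_eq0 /= => nh1.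
  (* With $h_0=0$ the roots are $(1:0)$ and $(-h_2:h_1)$. *)
  exists (mx2 1 (- h2) 0 h1).
  rewrite lin_subst_quadratic mx2_unit; eexists; first by rewrite mul1r mulr0 subr0.
  by congr (bform [:: _; _; _]); ring.
case/(closed_exp_root (ltn0Sn 1)) => x nx hx.
(* The quadratic formula, with [x] a square root of the discriminant: the roots are $(-h_1\pm
   x:2h_0)$. *)
exists (mx2 (- h1 + x) (- h1 - x) (2%:R * h0) (2%:R * h0)).
rewrite lin_subst_quadratic mx2_unit; eexists.
  have -> : (- h1 + x) * (2%:R * h0) - (- h1 - x) * (2%:R * h0) =
      4%:R * (h0 * x) by ring.
  by rewrite !mulf_neq0 ?nz.
have e : x ^+ 2 - (h1 ^+ 2 - 4%:R * h0 * h2) = 0 by rewrite hx subrr.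
congr (bform [:: _; _; _]).
  by rewrite -[RHS](mulr0 h0) -e; ring.
by rewrite -[RHS](mulr0 h0) -e; ring.
Qed.

(** $D$ is $-1/2$ times the discriminant of the Hessian, so the Hessian can be moved to a multiple
    of $xy$. This kills the middle coefficients of the cubic, and cube roots rescale the outer ones
    to 1. *)
Lemma cubic_normal_form (G : {mpoly k[2]}) : G \is 3.-homog -> inv_D G != 0 ->
  exists2 M : 'M[k]_2, M \in unitmx & lin_subst M G = bform [:: 1; 0; 0; 1].
Proof.
have hess s0 s1 s2 s3 : cov_h (bform [:: s0; s1; s2; s3]) =
    bform [:: (6%:R * s0 * s2 - 2%:R * s1 ^+ 2) / 9%:R;
              (18%:R * s0 * s3 - 2%:R * s1 * s2) / 9%:R;
              (6%:R * s1 * s3 - 2%:R * s2 ^+ 2) / 9%:R] :> {mpoly k[2]}.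
  rewrite /cov_h (transvectant_bform char0 (c := 6) (d := 6)
    (m := 3) (n := 3) (r := 2) _ _ isT isT erefl erefl).
  congr bform; rewrite /=.
  by congr [:: _; _; _]; field; rewrite ?oner_neq0 ?nz.
have disc h0 h1 h2 :
    full_transvectant 2 (bform [:: h0; h1; h2]) (bform [:: h0; h1; h2]) =
    - (h1 ^+ 2 - 4%:R * h0 * h2) / 2%:R :> k.
  rewrite (full_transvectant_bform char0); [|by []|by []].
  by rewrite bin_row2 /=; field; rewrite ?oner_neq0 ?nz.
move=> homG nD.
have [M uM [e hM]] : exists2 M : 'M[k]_2, M \in unitmx &
    exists e, cov_h (lin_subst M G) = bform [:: 0; e; 0].
  move: homG nD => /homog_bform [[|s0 [|s1 [|s2 [|s3 [|? ?]]]]] //= _ ->].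
  rewrite -/(bform [:: s0; s1; s2; s3]) /inv_D hess disc => nD.
  have [|M [e uM hM]] := @quadratic_normal_form
    ((6%:R * s0 * s2 - 2%:R * s1 ^+ 2) / 9%:R)
    ((18%:R * s0 * s3 - 2%:R * s1 * s2) / 9%:R)
    ((6%:R * s1 * s3 - 2%:R * s2 ^+ 2) / 9%:R).
    by apply: contraNneq nD => ->; rewrite oppr0 mul0r.
  exists M => //; exists (\det M ^+ 2 * e).
  rewrite /cov_h -[lin_subst M _]scale1r transvectant_lin_subst.
  rewrite -/(cov_h _) hess hM -bform_scale /= !mulr0 !mul1r.
  by [].
have nD1 : inv_D (lin_subst M G) != 0.
  have nd : \det M != 0 by rewrite -unitfE -unitmxE.
  (* The weight law is applied with [a] equal to the inverse of [\det M], which makes the scalar on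
     the cubic equal to 1. *)
  rewrite -[lin_subst M G]scale1r -(mulVf nd) inv_D_lin.
  by rewrite !mulf_neq0 ?expf_neq0 ?invr_neq0.
have {nD homG} : lin_subst M G \is 3.-homog by apply: lin_subst_homog.
move: hM nD1 => + + /homog_bform [s sz Gs]; rewrite Gs.
case: s sz Gs => [|s0 [|s1 [|s2 [|s3 [|? ?]]]]] // _ Gs.
rewrite /inv_D hess => hM; rewrite hM disc => nD1.
have /(bform_inj _) /= -/(_ erefl) [] := hM.
have n9 : 9%:R^-1 != 0 :> k by rewrite invr_neq0 ?nz.
move=> /eqP; rewrite mulf_eq0 (negbTE n9) orbF => /eqP e02 e03.
move=> /eqP; rewrite mulf_eq0 (negbTE n9) orbF => /eqP e13.
have ne : e != 0.
  by apply: contraNneq nD1 => ->; rewrite expr0n mulr0 subr0 oppr0 mul0r.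
have n2 : 2%:R != 0 :> k := nz 1.
(* A syzygy: $s_1s_2$ times the middle Hessian coefficient is a combination of the two outer ones,
   both zero. *)
have s12 : s1 * s2 * e = 0.
  have -> : s1 * s2 * e = ((6%:R * s0 * s2 - 2%:R * s1 ^+ 2) * (3%:R * s1 * s3)
      + s1 ^+ 2 * (6%:R * s1 * s3 - 2%:R * s2 ^+ 2)) / 9%:R.
    by rewrite -e03; field; rewrite nz.
  by rewrite e02 e13 mul0r mulr0 add0r mul0r.
(* If one of the two vanishes, an outer Hessian coefficient reduces to a multiple of the square of
   the other. *)
have [s1_0 s2_0] : s1 = 0 /\ s2 = 0.
  move/eqP: s12; rewrite !mulf_eq0 (negbTE ne) orbF => /orP[] /eqP z.
    move/eqP: e13; rewrite z mulr0 mul0r sub0r oppr_eq0 mulf_eq0 (negbTE n2).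
    by rewrite expf_eq0 => /eqP.
  move/eqP: e02; rewrite z mulr0 sub0r oppr_eq0 mulf_eq0 (negbTE n2).
  by rewrite expf_eq0 => /eqP.
have [ns0 ns3] : s0 != 0 /\ s3 != 0.
  by split; apply: contraNneq ne => z; rewrite -e03 s1_0 z !(mulr0, mul0r) subr0 mul0r.
have [||x nx hx] := @closed_exp_root 3 s0^-1; rewrite ?invr_eq0 //.
have [||y ny hy] := @closed_exp_root 3 s3^-1; rewrite ?invr_eq0 //.
exists (M *m mx2 x 0 0 y).
  by rewrite unitmx_mul uM mx2_unit mul0r subr0 mulf_neq0.
rewrite -lin_subst_comp Gs s1_0 s2_0 lin_subst_diag -[RHS]/(bform [:: 1; 0; 0; 1]).
congr bform; rewrite /=.
congr [:: _; _; _; _]; rewrite ?mul0r ?mulr0 //.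
  by rewrite hx mulfV.
by rewrite expr0 mulr1 !mulrA -expr2 -exprSr hy mulVf.
Qed.

End Roots.

(** * The Clebsch-Gordan pair *)

(** This identity and the next are the computational core of [cg_conj]: [e] stands for [c / \det M],
    and $d,-b,-c,a$ are the entries of the adjugate of $M$. *)
Lemma cg_quintic_comb (R : comPzRingType) (e a b c d x y f0 f1 : R) :
  y * (e * (d * f0 + - b * f1)) - x * (e * (- c * f0 + a * f1)) =
  e * ((c * x + d * y) * f0 - (a * x + b * y) * f1).
Proof. ring. Qed.

Lemma cg_cubic_comb (R : comPzRingType) (e a b c d x0 x1 y0 y1 : R) :
  e * (d * (a * x0 + c * x1) + - b * (a * y0 + c * y1)) +
  e * (- c * (b * x0 + d * x1) + a * (b * y0 + d * y1)) =
  e * (a * d - b * c) * (x0 + y1).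
Proof. ring. Qed.

Section ClebschGordan.
Variable k : fieldType.
Implicit Types (f : 'I_2 -> {mpoly k[2]}) (M N : 'M[k]_2).
Implicit Types (F G : {mpoly k[2]}).

(** Stated for an arbitrary pair of forms, because a conjugate lift is not packaged as a
    [ratmap]. *)
Definition cg_quintic f := 'X_1 * f 0 - 'X_0 * f 1.
Definition cg_cubic f := (f 0)^`M(0) + (f 1)^`M(1).

Lemma cg_quintic_homog f : (forall i, f i \is 4.-homog) -> cg_quintic f \is 5.-homog.
Proof.
move=> hf; rewrite /cg_quintic -[5%N]/(1 + 4)%N.
by apply: rpredB; rewrite dhomogM ?hf // dhomogX /= mdeg1.
Qed.

Lemma mderiv_homog n (p : {mpoly k[2]}) i :
  p \is n.+1.-homog -> p^`M(i) \is n.-homog.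
Proof.
case/homog_bform => s sz ->; case: (ord2_cases i) => ->.
  by rewrite mderiv0_bform bform_homog // size_ldx sz.
by rewrite mderiv1_bform bform_homog // size_ldy sz.
Qed.

Lemma cg_cubic_homog f : (forall i, f i \is 4.-homog) -> cg_cubic f \is 3.-homog.
Proof. by move=> hf; rewrite /cg_cubic rpredD // mderiv_homog ?hf. Qed.

(** On the right the derivatives of $f_1$ cancel, and Euler's identity turns $xf_{0,x}+yf_{0,y}$
    into $4f_0$. *)
Lemma cg_recover0 f : f 0 \is 4.-homog ->
  5%:R *: f 0 = (cg_quintic f)^`M(1) + 'X_0 * cg_cubic f.
Proof.
move=> /euler h; rewrite /cg_quintic /cg_cubic mderivB !mderivM !mderivXU /=.
rewrite mpolyC0 mpolyC1 mul0r add0r mul1r mulrDr.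
rewrite (_ : 5%:R = 4%:R + 1) ?natr1 // scalerDl scale1r -h.
ring.
Qed.

Lemma cg_recover1 f : f 1 \is 4.-homog ->
  5%:R *: f 1 = 'X_1 * cg_cubic f - (cg_quintic f)^`M(0).
Proof.
move=> /euler h; rewrite /cg_quintic /cg_cubic mderivB !mderivM !mderivXU /=.
rewrite mpolyC0 mpolyC1 mul0r add0r mul1r mulrDr.
rewrite (_ : 5%:R = 4%:R + 1) ?natr1 // scalerDl scale1r -h.
ring.
Qed.

Lemma cg_inj f g : 5%:R != 0 :> k ->
  (forall i, f i \is 4.-homog) -> (forall i, g i \is 4.-homog) ->
  cg_quintic f = cg_quintic g -> cg_cubic f = cg_cubic g -> f =1 g.
Proof.
move=> n5 hf hg eF eG i; apply: (scalerI n5).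
by case: (ord2_cases i) => ->; rewrite ?cg_recover0 ?cg_recover1 // eF eG.
Qed.

Lemma invmx2 M : M \in unitmx ->
  invmx M = (\det M)^-1 *: mx2 (M 1 1) (- M 0 1) (- M 1 0) (M 0 0).
Proof.
move=> uM; rewrite -[invmx M]mulmx1; apply: (canLR (mulKmx uM)); apply/matrixP => i j.
have nd : \det M != 0 by rewrite -unitfE -unitmxE.
rewrite -scalemxAr !mxE !big_ord_recl big_ord0 !mxE.
rewrite (_ : lift _ _ = 1); last exact: val_inj.
by move: nd; rewrite det_mx2;
  case: (ord2_cases i) => ->; case: (ord2_cases j) => -> /= nd; field.
Qed.

(** With $v=(x,y)$ the quintic is $\det(f,v)$, and $\det(M^{-1}f(Mv),v)=\det(M)^{-1}\det(f(Mv),Mv)$.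
    The cubic is the trace of the Jacobian of $f$, which conjugation by $M$ preserves. *)
Lemma cg_conj c M f : M \in unitmx ->
  cg_quintic (fun i => c *: conj_lift M f i) =
    (c / \det M) *: lin_subst M (cg_quintic f) /\
  cg_cubic (fun i => c *: conj_lift M f i) = c *: lin_subst M (cg_cubic f).
Proof.
move=> uM; have nd : \det M != 0 by rewrite -unitfE -unitmxE.
have conjE i : c *: conj_lift M f i = (c / \det M) *:
    (mx2 (M 1 1) (- M 0 1) (- M 1 0) (M 0 0) i 0 *: lin_subst M (f 0)
     + mx2 (M 1 1) (- M 0 1) (- M 1 0) (M 0 0) i 1 *: lin_subst M (f 1)).
  rewrite /conj_lift invmx2 // 2!big_ord_recl big_ord0 addr0.
  rewrite (_ : lift _ _ = 1); last exact: val_inj.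
  by rewrite [LHS]scalerDr [RHS]scalerDr !scalerA ![(_ *: mx2 _ _ _ _) _ _]mxE !mulrA.
split.
  rewrite /cg_quintic !conjE !mxE /= lin_substB !lin_substM !lin_substX.
  rewrite -!mul_mpolyC !mpolyCN.
  exact: cg_quintic_comb.
rewrite /cg_cubic !conjE !mxE /= !mderivZ !mderivD !mderivZ !mderiv_lin_subst.
rewrite lin_substD.
rewrite -!mul_mpolyC !mpolyCN.
have -> : c%:MP = (c / \det M)%:MP *
    ((M 0 0)%:MP * (M 1 1)%:MP - (M 0 1)%:MP * (M 1 0)%:MP) :> {mpoly k[2]}.
  by rewrite -!mpolyCM -mpolyCB -mpolyCM -det_mx2 divfK.
exact: cg_cubic_comb.
Qed.

End ClebschGordan.

(** * Classification *)

Section Classification.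
Variable k : closedFieldType.
Hypothesis char0 : [pchar k] =i pred0.
Let nz := natr_neq0 char0.
Implicit Types (F G : {mpoly k[2]}) (M N : 'M[k]_2) (a b : nat -> k).

Lemma ringN_neq0 q : ring_of_N k (BinNums.Npos q) != 0.
Proof.
rewrite ring_of_NE.
have: (0 < nat_of_bin (BinNums.Npos q))%N.
  elim: q => [q IH|q IH|] //=; rewrite NatTrec.doubleE ?double_gt0 //.
by case: nat_of_bin => // n _; rewrite nz.
Qed.

(* Otherwise unification and [done] expand these polynomials. *)
#[local] Opaque P1 P2 P3 P4 P5 P6 inv_D.

(** The $U_i$ on arbitrary pairs, so that they can be evaluated at normal forms that are not
    presented as pairs of maps. *)
Definition Uvals F G : seq k :=
  [:: P1 F G / (3%:K * inv_D G ^+ 1); P2 F G / (54%:K * inv_D G ^+ 3);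
      P3 F G / (20432412%:K * inv_D G ^+ 4); P4 F G / (18%:K * inv_D G ^+ 3);
      P5 F G / (2270268%:K * inv_D G ^+ 4); P6 F G / (27027%:K * inv_D G ^+ 6)].

Lemma Uvals_lin M c F G : M \in unitmx -> c != 0 ->
  Uvals ((c / \det M) *: lin_subst M F) (c *: lin_subst M G) = Uvals F G.
Proof.
rewrite unitmxE unitfE => nd nc.
(* Brings the pair into the shape [a], [a * d] required by the weight laws. *)
have -> : c *: lin_subst M G = (c / \det M * \det M) *: lin_subst M G by rewrite divfK.
rewrite /Uvals P1_lin P2_lin P3_lin P4_lin P5_lin P6_lin inv_D_lin.
have : (c / \det M) ^+ 4 * \det M ^+ 10 != 0.
  by rewrite mulf_neq0 ?expf_neq0 // mulf_neq0 ?invr_neq0.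
move: (_ * _ : k) => w nw.
have E e m p D : w ^+ m * p / (e * (w * D) ^+ m) = p / (e * D ^+ m).
  rewrite exprMn [e * _]mulrCA -mulf_div divff ?mul1r // expf_neq0 //.
have E1 e p D : w * p / (e * (w * D) ^+ 1) = p / (e * D ^+ 1) by exact: (E e 1%N).
by rewrite E1 !E.
Qed.

(** Conjugation by [M] with scalar 1. Common factors are covered: the scalar matrix $\lambda I$
    multiplies both forms by $\lambda^3$. *)
Definition moves M F G F' G' :=
  F' = (\det M)^-1 *: lin_subst M F /\ G' = lin_subst M G.

Lemma Uvals_moves M F G F' G' : M \in unitmx -> moves M F G F' G' ->
  Uvals F' G' = Uvals F G.
Proof.
move=> uM [-> ->]; rewrite -(Uvals_lin F G uM (oner_neq0 k)).
by rewrite div1r scale1r.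
Qed.

Lemma moves_comp M N F G F1 G1 F2 G2 :
  moves M F G F1 G1 -> moves N F1 G1 F2 G2 -> moves (M *m N) F G F2 G2.
Proof.
move=> [-> ->] [-> ->]; split; last by rewrite lin_subst_comp.
by rewrite lin_substZ scalerA lin_subst_comp det_mulmx invfM mulrC.
Qed.

Lemma moves_inv M F G F' G' : M \in unitmx -> moves M F G F' G' ->
  moves (invmx M) F' G' F G.
Proof.
move=> uM [-> ->]; have nd : \det M != 0 by rewrite -unitfE -unitmxE.
split; last by rewrite lin_subst_comp mulmxV // lin_subst1.
rewrite lin_substZ scalerA lin_subst_comp mulmxV // lin_subst1 det_inv invrK.
by rewrite mulfV // scale1r.
Qed.

Definition nfG : {mpoly k[2]} := bform [:: 1; 0; 0; 1].
Definition nfF a : {mpoly k[2]} :=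
  bform [:: a 0%N; 5%:R * a 1%N; 10%:R * a 2%N; 10%:R * a 3%N; 5%:R * a 4%N;
            a 5%N].

Lemma quintic_nfF F : F \is 5.-homog -> exists a, F = nfF a.
Proof.
case/homog_bform => s sz ->.
exists (fun i => s`_i / 'C(5, i)%:R); rewrite /nfF.
rewrite -[ 'C(5, 0)]/1%N -['C(5, 1)]/5%N -['C(5, 2)]/10%N -['C(5, 3)]/10%N
  -['C(5, 4)]/5%N -['C(5, 5)]/1%N !divr1.
rewrite ![_ %:R * (_ / _)]mulrC !divfK ?nz //; congr bform.
by case: s sz => [|? [|? [|? [|? [|? [|? [|? ?]]]]]]].
Qed.

(* p and p' of the introductory comment. *)
Let pl a := a 0%N + 98%:R * a 3%N.
Let pr a := a 5%N + 98%:R * a 2%N.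

(** The power comes from $y\mapsto zy$, the division from the determinant. For $z^3=1$, $p$ is
    divided by $z$, $p'$ is multiplied by $z$, and $a_1,a_4$ are fixed. *)
Definition diag_coef z a i := z ^+ i / z * a i.
(** The sign is the determinant of the exchange of $x$ and $y$. It sends $(p,p')$ to $(-p',-p)$ and
    preserves $a_4-a_1$. *)
Definition swap_coef a i : k := - a (5 - i)%N.

Lemma moves_diag z a : z ^+ 3 = 1 ->
  moves (mx2 1 0 0 z) (nfF a) nfG (nfF (diag_coef z a)) nfG.
Proof.
move=> z3; have nzz : z != 0.
  by apply: contra_eq_neq z3 => ->; rewrite expr0n eq_sym oner_neq0.
split; rewrite /nfF /nfG lin_subst_diag.
  rewrite det_mx2E -bform_scale; congr bform; rewrite /diag_coef.
  by rewrite /=; congr [:: _; _; _; _; _; _]; field.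
congr bform; rewrite /=; congr [:: _; _; _; _]; last rewrite -[LHS]z3.
all: ring.
Qed.

Lemma moves_swap a : moves (mx2 0 1 1 0) (nfF a) nfG (nfF (swap_coef a)) nfG.
Proof.
split; rewrite /nfF /nfG lin_subst_swap //.
rewrite det_mx2E -bform_scale; congr bform; rewrite /swap_coef /rev /=.
by congr [:: _; _; _; _; _; _]; field; rewrite ?oppr_eq0 ?oner_neq0.
Qed.

(** Both terms share the factor $-5^{12}/3^9$, and $4p^3p'^3+(p^3-p'^3)^2=(p^3+p'^3)^2$. *)
Lemma nf_discriminant a :
  let U := Uvals (nfF a) nfG in
  U`_1 ^+ 3 / 2%:R - 27%:R * U`_2 ^+ 2 =
  - (5%:R ^+ 12 / 3%:R ^+ 9) * (pl a ^+ 3 + pr a ^+ 3) ^+ 2.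
Proof.
rewrite /Uvals /= (P2_nf char0) (P3_nf char0) (inv_D_nf char0) -/(pl a) -/(pr a).
have nn : - 2%:R != 0 :> k by rewrite oppr_eq0 nz.
have den q n : ring_of_N k (BinNums.Npos q) * (- 2%:R) ^+ n != 0.
  by rewrite mulf_neq0 ?ringN_neq0 ?expf_neq0.
have U2E (x : k) : 20000%:K * x / (54%:K * (- 2%:R) ^+ 3) = - (1250%:K / 27%:R * x).
  rewrite mulrAC -mulNr; congr (_ * x); apply/eqP.
  by rewrite -mulNr eqr_div ?den ?nz //; apply/eqP; rewrite /=; ring.
have U3E (x : k) : 7007000000%:K * x / (20432412%:K * (- 2%:R) ^+ 4) =
    5%:R ^+ 6 / 3%:R ^+ 6 * x.
  rewrite mulrAC; congr (_ * x); apply/eqP.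
  by rewrite eqr_div ?den ?expf_neq0 ?nz //; apply/eqP; rewrite /=; ring.
rewrite U2E U3E; move: (pl a) (pr a) => x y; rewrite /=.
by field; rewrite ?oner_neq0 ?nz.
Qed.

Lemma Uvals_numerators F F' G : inv_D G != 0 -> Uvals F G = Uvals F' G ->
  [/\ P1 F G = P1 F' G, P2 F G = P2 F' G & P3 F G = P3 F' G] /\
  [/\ P4 F G = P4 F' G, P5 F G = P5 F' G & P6 F G = P6 F' G].
Proof.
move=> nD.
have canc (x y : k) q n : x / (ring_of_N k (BinNums.Npos q) * inv_D G ^+ n) =
    y / (ring_of_N k (BinNums.Npos q) * inv_D G ^+ n) -> x = y.
  by apply: mulIf; rewrite invr_neq0 // mulf_neq0 ?ringN_neq0 ?expf_neq0.
move=> eU; have e i := congr1 (nth 0 ^~ i) eU; clear eU.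
split; split; [exact: (canc _ _ _ _ (e 0%N)) | exact: (canc _ _ _ _ (e 1%N))
  | exact: (canc _ _ _ _ (e 2%N)) | exact: (canc _ _ _ _ (e 3%N))
  | exact: (canc _ _ _ _ (e 4%N)) | exact: (canc _ _ _ _ (e 5%N))].
Qed.

Lemma P_nfF a :
  [/\ P1 (nfF a) nfG = 1400%:K * (a 4%N - a 1%N),
      P2 (nfF a) nfG = 20000%:K * (pl a * pr a) &
      P3 (nfF a) nfG = 7007000000%:K * (pl a ^+ 3 - pr a ^+ 3)] /\
  [/\ P4 (nfF a) nfG = 5644800%:K * (pl a * a 2%N + pr a * a 3%N)
        - 119200%:K * (pl a * pr a),
      P5 (nfF a) nfG = 41761720000%:K * (pr a ^+ 3 - pl a ^+ 3)
        - 3955311360000%:K * (pr a ^+ 2 * a 2%N - pl a ^+ 2 * a 3%N) &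
      P6 (nfF a) nfG =
        - (70070000000%:K * ((a 1%N + a 4%N) * (pl a ^+ 3 + pr a ^+ 3)))].
Proof.
split; split; [exact: P1_nf | exact: P2_nf | exact: P3_nf | exact: P4_nf
  | exact: P5_nf | exact: P6_nf].
Qed.

Lemma Uvals_nf a b : Uvals (nfF a) nfG = Uvals (nfF b) nfG ->
  [/\ a 4%N - a 1%N = b 4%N - b 1%N, pl a * pr a = pl b * pr b &
      pl a ^+ 3 - pr a ^+ 3 = pl b ^+ 3 - pr b ^+ 3] /\
  [/\ pl a * a 2%N + pr a * a 3%N = pl b * b 2%N + pr b * b 3%N,
      pr a ^+ 2 * a 2%N - pl a ^+ 2 * a 3%N =
        pr b ^+ 2 * b 2%N - pl b ^+ 2 * b 3%N &
      (a 1%N + a 4%N) * (pl a ^+ 3 + pr a ^+ 3) =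
        (b 1%N + b 4%N) * (pl b ^+ 3 + pr b ^+ 3)].
Proof.
have nD : inv_D nfG != 0 by rewrite (inv_D_nf char0) oppr_eq0 nz.
case/(Uvals_numerators nD) => -[h1 h2 h3] [h4 h5 h6].
have [[a1 a2 a3] [a4 a5 a6]] := P_nfF a; have [[b1 b2 b3] [b4 b5 b6]] := P_nfF b.
have {h1 a1 b1} /(mulfI (ringN_neq0 _)) e1 := etrans (esym a1) (etrans h1 b1).
have {h2 a2 b2} /(mulfI (ringN_neq0 _)) e2 := etrans (esym a2) (etrans h2 b2).
have {h3 a3 b3} /(mulfI (ringN_neq0 _)) e3 := etrans (esym a3) (etrans h3 b3).
have {h4 a4 b4} := etrans (esym a4) (etrans h4 b4).
have {h5 a5 b5} := etrans (esym a5) (etrans h5 b5).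
have {h6 a6 b6} := etrans (esym a6) (etrans h6 b6).
move=> /oppr_inj /(mulfI (ringN_neq0 _)) e6 + +.
have e3' : pr a ^+ 3 - pl a ^+ 3 = pr b ^+ 3 - pl b ^+ 3.
  by rewrite -opprB e3 opprB.
(* The parts of $P_4$ and $P_5$ that depend only on $pp'$ and $p^3-p'^3$ already agree and are
   cancelled. *)
rewrite e3' e2 => /addrI /oppr_inj /(mulfI (ringN_neq0 _)) e5.
by move=> /addIr /(mulfI (ringN_neq0 _)) e4.
Qed.

(** Cramer's rule for $a_2,a_3$, whose system has determinant $-(p^3+p'^3)$; the sum and difference
    of $a_1,a_4$ give these two, and $p,p'$ then give $a_0,a_5$. *)
Lemma nfF_aligned a b : Uvals (nfF a) nfG = Uvals (nfF b) nfG ->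
  pl a = pl b -> pr a = pr b -> pl b ^+ 3 + pr b ^+ 3 != 0 -> nfF a = nfF b.
Proof.
move=> /Uvals_nf [[e1 _ _] [+ + +]] epl epr nq; rewrite epl epr => e4 e5.
move/(mulIf nq) => e6.
have e2 : a 2%N = b 2%N.
  apply: (mulfI nq); apply/eqP; rewrite -subr_eq0; apply/eqP.
  transitivity (pl b ^+ 2 *
      ((pl b * a 2%N + pr b * a 3%N) - (pl b * b 2%N + pr b * b 3%N))
    + pr b * ((pr b ^+ 2 * a 2%N - pl b ^+ 2 * a 3%N)
              - (pr b ^+ 2 * b 2%N - pl b ^+ 2 * b 3%N))).
    by ring.
  by rewrite e4 e5 !subrr !mulr0 addr0.
have e3 : a 3%N = b 3%N.
  apply: (mulfI nq); apply/eqP; rewrite -subr_eq0; apply/eqP.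
  transitivity (pr b ^+ 2 *
      ((pl b * a 2%N + pr b * a 3%N) - (pl b * b 2%N + pr b * b 3%N))
    - pl b * ((pr b ^+ 2 * a 2%N - pl b ^+ 2 * a 3%N)
              - (pr b ^+ 2 * b 2%N - pl b ^+ 2 * b 3%N))).
    by ring.
  by rewrite e4 e5 !subrr !mulr0 subr0.
have e4' : a 4%N = b 4%N.
  apply: (mulfI (nz 1)).
  transitivity ((a 4%N - a 1%N) + (a 1%N + a 4%N)); first by ring.
  by rewrite e1 e6; ring.
have e1' : a 1%N = b 1%N by apply: (@addIr _ (a 4%N)); rewrite e6 e4'.
move: epl epr; rewrite /pl /pr e2 e3 => /addIr e0 /addIr e5'.
by rewrite /nfF e0 e1' e2 e3 e4' e5'.
Qed.

(** The root of unity is $p/p'$, and equality of the products makes it act inversely on $q$. If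
    $p'=0$ then $q'\ne0$, and $q'/q$ serves instead. *)
Lemma align_cube (p q p' q' : k) : p * q = p' * q' -> p ^+ 3 = p' ^+ 3 ->
  q ^+ 3 = q' ^+ 3 -> p' ^+ 3 + q' ^+ 3 != 0 ->
  exists2 z, z ^+ 3 = 1 & p / z = p' /\ z * q = q'.
Proof.
have c3 (x : k) : (x == 0) = (x ^+ 3 == 0) by rewrite expf_eq0.
move=> epq ep eq nq; have [p'0|np'] := eqVneq p' 0.
  have nq' : q' != 0.
    by apply: contraNneq nq => ->; rewrite p'0 expr0n addr0.
  have p0 : p = 0 by apply/eqP; rewrite c3 ep p'0 expr0n.
  have nq0 : q != 0 by rewrite c3 eq -c3.
  exists (q' / q); first by rewrite expr_div_n eq divff // expf_neq0.
  by rewrite p0 p'0 mul0r divfK.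
have np : p != 0 by rewrite c3 ep -c3.
exists (p / p'); first by rewrite expr_div_n ep divff // expf_neq0.
split; first by rewrite invf_div mulrC divfK.
by rewrite mulrAC epq mulrC mulKf.
Qed.

(** The sum and product of $p^3$ and $-p'^3$ are fixed by $U_3$ and $U_2$, so the unordered pair is
    known. The swap corrects the order and a cube root of unity then aligns $p$ and $p'$
    themselves. *)
Lemma nf_conj a b : Uvals (nfF a) nfG = Uvals (nfF b) nfG ->
  pl b ^+ 3 + pr b ^+ 3 != 0 ->
  exists2 M, M \in unitmx & moves M (nfF a) nfG (nfF b) nfG.
Proof.
wlog epl : a / pl a ^+ 3 = pl b ^+ 3 => [hw eU nq|].
  have [[_ e2 e3] _] := Uvals_nf eU.
  (* The quadratic with roots $p_b^3$ and $-p_b'^3$, evaluated at $p_a^3$. *)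
  have : (pl a ^+ 3 - pl b ^+ 3) * (pl a ^+ 3 + pr b ^+ 3) = 0.
    have e3' : pl a ^+ 3 - pr a ^+ 3 - (pl b ^+ 3 - pr b ^+ 3) = 0 by rewrite e3 subrr.
    have e2' : (pl a * pr a) ^+ 3 - (pl b * pr b) ^+ 3 = 0 by rewrite e2 subrr.
    transitivity (pl a ^+ 3 * (pl a ^+ 3 - pr a ^+ 3 - (pl b ^+ 3 - pr b ^+ 3))
      + ((pl a * pr a) ^+ 3 - (pl b * pr b) ^+ 3)); first by ring.
    by rewrite e3' e2' mulr0 addr0.
  move/eqP; rewrite mulf_eq0 => /orP[]; rewrite ?subr_eq0 ?addr_eq0 => /eqP epl.
    exact: hw.
  have us : (mx2 0 1 1 0 : 'M[k]_2) \in unitmx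
    by rewrite mx2_unit mul0r sub0r mulr1 oppr_eq0 oner_eq0.
  have mv := moves_swap a.
  have epl' : pl (swap_coef a) ^+ 3 = pl b ^+ 3.
    have -> : pl (swap_coef a) = - pr a.
      by rewrite /pl /pr /swap_coef !subSS !subn0; ring.
    rewrite exprNn -signr_odd /= expr1 mulN1r.
    by apply: (addrI (pl a ^+ 3)); rewrite e3 epl addrC.
  have [M uM hM] := hw _ epl' (etrans (Uvals_moves us mv) eU) nq.
  by exists (mx2 0 1 1 0 *m M); [rewrite unitmx_mul us | exact: moves_comp mv hM].
move=> eU nq; have [[_ e2 e3] _] := Uvals_nf eU.
have epr : pr a ^+ 3 = pr b ^+ 3.
  by apply: oppr_inj; apply: (addrI (pl a ^+ 3)); rewrite e3 epl.
have [z z3 [el er]] := align_cube e2 epl epr nq.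
have nzz : z != 0 by apply: contra_eq_neq z3 => ->; rewrite expr0n eq_sym oner_neq0.
have mv := moves_diag a z3.
have uM : mx2 1 0 0 z \in unitmx by rewrite mx2_unit mul1r mulr0 subr0.
have epl' : pl (diag_coef z a) = pl b.
  by rewrite -el /pl /diag_coef z3 expr0 !div1r mulrDl; ring.
have epr' : pr (diag_coef z a) = pr b.
  rewrite -er /pr /diag_coef.
  have -> : z ^+ 5 = z ^+ 2 by rewrite (exprD z 3 2) z3 mul1r.
  by field.
have e := nfF_aligned (etrans (Uvals_moves uM mv) eU) epl' epr' nq.
exists (mx2 1 0 0 z); first exact: uM.
exact: (eq_ind _ (fun F => moves _ _ _ F _) mv _ e).
Qed.

Lemma pair_normal_form F G : F \is 5.-homog -> G \is 3.-homog -> inv_D G != 0 ->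
  exists2 M, M \in unitmx & exists a, moves M F G (nfF a) nfG.
Proof.
move=> hF hG /(cubic_normal_form char0 hG) [M uM eG]; exists M => //.
have [a ea] : exists a, (\det M)^-1 *: lin_subst M F = nfF a.
  by apply: quintic_nfF; rewrite dhomogZ // lin_subst_homog.
by exists a; split.
Qed.

(** Both pairs are normalised, the normal forms are matched, and the second normalisation is
    undone. *)
Lemma Uvals_complete F G F' G' :
  F \is 5.-homog -> G \is 3.-homog -> F' \is 5.-homog -> G' \is 3.-homog ->
  inv_D G != 0 -> inv_D G' != 0 ->
  (Uvals F' G')`_1 ^+ 3 / 2%:R - 27%:R * (Uvals F' G')`_2 ^+ 2 != 0 ->
  Uvals F G = Uvals F' G' ->
  exists2 M, M \in unitmx & moves M F G F' G'.
Proof.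
move=> hF hG hF' hG' nD nD' nU eU.
have [M uM [a ha]] := pair_normal_form hF hG nD.
have [N uN [b hb]] := pair_normal_form hF' hG' nD'.
(* The excluded quantity is invariant, so it can be read at the normal form of the second pair. *)
have nq : pl b ^+ 3 + pr b ^+ 3 != 0.
  apply: contraNneq nU => q0.
  by rewrite -(Uvals_moves uN hb) nf_discriminant q0 expr0n mulr0.
have eab := etrans (Uvals_moves uM ha) (etrans eU (esym (Uvals_moves uN hb))).
have [S uS hS] := nf_conj eab nq.
exists (M *m S *m invmx N); first by rewrite !unitmx_mul uM uS unitmx_inv.
exact: moves_comp (moves_comp ha hS) (moves_inv uN hb).
Qed.

End Classification.

Theorem corollary5p6 (k : closedFieldType) (char0 : [pchar k] =i pred0)
    (phi psi : ratmap k 4)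
    (Dphi : Dinv phi != 0)
    (Uphi : U2 phi ^+ 3 / 2%:R - 27%:R * U3 phi ^+ 2 != 0)
    (Dpsi : Dinv psi != 0)
    (Upsi : U2 psi ^+ 3 / 2%:R - 27%:R * U3 psi ^+ 2 != 0) :
  conjugate phi psi <->
  U1 phi = U1 psi /\ U2 phi = U2 psi /\ U3 phi = U3 psi /\
  U4 phi = U4 psi /\ U5 phi = U5 psi /\ U6 phi = U6 psi.
Proof.
have hF (f : ratmap k 4) : cgF f \is 5.-homog by apply/cg_quintic_homog/rm_homog.
have hG (f : ratmap k 4) : cgG f \is 3.-homog by apply/cg_cubic_homog/rm_homog.
have UE (f : ratmap k 4) : Uvals (cgF f) (cgG f) =
    [:: U1 f; U2 f; U3 f; U4 f; U5 f; U6 f] by [].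
split=> [[M [c [uM nc e]]]|[e1 [e2 [e3 [e4 [e5 e6]]]]]].
  have [eF eG] := cg_conj c phi uM.
  have eF' : cgF psi = (c / \det M) *: lin_subst M (cgF phi).
    by apply: etrans eF; rewrite /cgF !e.
  have eG' : cgG psi = c *: lin_subst M (cgG phi).
    by apply: etrans eG; rewrite /cgG !e.
  have := Uvals_lin (cgF phi) (cgG phi) uM nc; rewrite -eF' -eG'.
  rewrite !UE => eU; have {eU} h i := congr1 (nth 0 ^~ i) (esym eU).
  exact: (conj (h 0%N) (conj (h 1%N) (conj (h 2%N) (conj (h 3%N)
    (conj (h 4%N) (h 5%N)))))).
have eU : Uvals (cgF phi) (cgG phi) = Uvals (cgF psi) (cgG psi).
  by rewrite !UE e1 e2 e3 e4 e5 e6.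
have nU : (Uvals (cgF psi) (cgG psi))`_1 ^+ 3 / 2%:R
    - 27%:R * (Uvals (cgF psi) (cgG psi))`_2 ^+ 2 != 0 by rewrite UE.
have [M uM [eF eG]] := Uvals_complete char0 (hF phi) (hG phi) (hF psi) (hG psi)
  Dphi Dpsi nU eU.
clear eU nU e1 e2 e3 e4 e5 e6 Uphi Upsi Dphi Dpsi.
(* The scalar is 1 by the normalisation in [moves]; equality of the two lifts follows because the
   Clebsch-Gordan pair determines a lift. *)
exists M, 1; split; [exact: uM | exact: oner_neq0 |].
have [cF cG] := cg_conj 1 phi uM.
apply: cg_inj (natr_neq0 char0 4) (rm_homog psi) _ _ _.
- move=> i; rewrite dhomogZ // rpred_sum // => j _.
  by rewrite dhomogZ // lin_subst_homog // rm_homog.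
- by rewrite cF div1r; exact: eF.
by rewrite cG scale1r; exact: eG.
Qed.
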